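(* Let $\alpha\in\mathbb{R}$ and let $f:\mathbb{S}^1\to\mathbb{S}^1$ be the rotation $f(x)=x+\alpha \bmod 1$ on $\mathbb{S}^1=\mathbb{R}/\mathbb{Z}$. Let $\varepsilon>0$, let $\vartheta_\varepsilon$ be the uniform distribution on $[-\varepsilon,\varepsilon]$, and perturb $f$ additively: for an i.i.d. sequence $\underline{\omega}=(\omega_1,\omega_2,\ldots)$ with common law $\vartheta_\varepsilon$, the random evolution of an initial state $x\in\mathbb{S}^1$ is $$f^n_{\underline{\omega}}(x)=f_{\omega_n}\circ f_{\omega_{n-1}}\circ\cdots\circ f_{\omega_1}(x),\qquad f_\omega(x)=f(x)+\omega \bmod 1,$$ with $f^0_{\underline\omega}(x)=x$. Let $X_n=\varphi\circ f^n_{\underline{\omega}}$, $n=0,1,2,\ldots$, be the stationary stochastic process generated by this random evolution and an observable $\varphi:\mathbb{S}^1\to\mathbb{R}\cup\{+\infty\}$ with a global maximum at $z\in\mathbb{S}^1$ (see the context), under the probability $\mathbb{P}=\mu_\varepsilon\times\vartheta_\varepsilon^{\mathbb{N}}$. Let $M_n=\max\{X_0,\ldots,X_{n-1}\}$. Let $\tau>0$ and let $(u_n)_{n\in\mathbb{N}}$ be a sequence of real numbers such that $$n\,\mathbb{P}(X_0>u_n)\to\tau\ \text{ as } n\to\infty,\qquad\text{and}\qquad \bigcap_{n\in\mathbb{N}}U_n=\{z\},\ \text{ where } U_n=\{y\in\mathbb{S}^1:\varphi(y)>u_n\}.$$ Then the process $X_0,X_1,\ldots$ satisfies conditions $D_2(u_n)$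 and $D'(u_n)$ (defined in the context), which implies that there exists an Extreme Value Law for $M_n$ with Extremal Index equal to $1$, i.e. $\bar H(\tau)=e^{-\tau}$: that is, $$\lim_{n\to\infty}\mathbb{P}(M_n\le u_n)=e^{-\tau}.$$
   Context: Stationary measure. $\mu_\varepsilon$ is the stationary measure of the random system, i.e. the probability measure on $\mathbb{S}^1$ with $\iint\phi(f_{\omega}(x))\,d\mu_\varepsilon(x)\,d\vartheta_\varepsilon(\omega)=\int\phi\,d\mu_\varepsilon$ for every $\phi\in L^\infty$; for the perturbed rotations considered here it is Lebesgue measure on $\mathbb{S}^1$, for every $\varepsilon$. The initial point $x$ is distributed according to $\mu_\varepsilon$, independently of $\underline{\omega}$. Observable. $\varphi:\mathbb{S}^1\to\mathbb{R}\cup\{+\infty\}$ is measurable and achieves a global maximum at $z$. It is assumed that for every $u<\varphi(z)$ sufficiently close to $\varphi(z)$ the set $\{y:\varphi(y)>u\}$ (identified with the event $\{X_0>u\}$) is a topological ball (an open arc) ''centred'' at $z$, and that the sets $U_n$ associated with the levels $u_n$, where $u_n\to\varphi(z)$, form a nested sequence of such balls. Condition $D_2(u_n)$. It holds for $X_0,X_1,\ldots$ if for all integers $\ell,t$ and $n$, $$\left|\mathbb{P}\big(X_0>u_n,\ \max\{X_t,\ldots,X_{t+\ell-1}\}\le u_n\big)-\mathbb{P}(X_0>u_n)\,\mathbb{P}(M_\ell\le u_n)\right|\le\gamma(n,t),$$ where $\gamma(n,t)$ is decreasing in $t$ for each $n$ and $n\gamma(n,t_n)\to0$ as $n\to\infty$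 for some sequence $t_n=o(n)$. Condition $D'(u_n)$. It holds for $X_0,X_1,\ldots$ if there exists a sequence of integers $(k_n)_{n\in\mathbb{N}}$ with $k_n\to\infty$ and $k_nt_n=o(n)$ (where $(t_n)$ is the sequence from condition $D_2(u_n)$) such that $$\lim_{n\to\infty}n\sum_{j=1}^{\lfloor n/k_n\rfloor}\mathbb{P}(X_0>u_n,\ X_j>u_n)=0.$$ Extreme Value Law and Extremal Index. There is an Extreme Value Law for $M_n$ if there is a non-degenerate distribution function $H$ with $H(0)=0$ such that for every $\tau>0$ there is a sequence $u_n=u_n(\tau)$ with $n\mathbb{P}(X_0>u_n)\to\tau$ and $\mathbb{P}(M_n\le u_n)\to\bar H(\tau)=1-H(\tau)$ (at continuity points of $H$). The Extremal Index is $\theta\in[0,1]$ if $\bar H(\tau)=e^{-\theta\tau}$ for all $\tau>0$. *)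

(* Defs.v *)
From HB Require Import structures.
From mathcomp Require Import all_boot all_order all_algebra.
From mathcomp Require Import all_classical all_reals all_analysis.
From mathcomp Require Import measurable_realfun.

Set Implicit Arguments.
Unset Strict Implicit.
Unset Printing Implicit Defensive.

Import Order.TTheory GRing.Theory Num.Theory.
Import numFieldNormedType.Exports.

Local Open Scope classical_set_scope.
Local Open Scope ring_scope.

Section Circle.
Variable R : realType.

(* The quotient group [R / Z]. [Num.int_num_subdef] is the predicate underlying [Num.int]; it is the
   form that carries the additive-subgroup structure. *)
Definition circle : Type :=
  {ideal_quot (GRing.ZmodClosed.clone R (@Num.int_num_subdef R) _)}.

HB.instance Definition _ := GRing.Zmodule.on circle.
HB.instance Definition _ := EqQuotient.on circle.

Definition toCircle (t : R) : circle := (\pi_circle t)%qT.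

Definition circle_open (U : set circle) := open (toCircle @^-1` U).

Let circle_openT : circle_open setT.
Proof. by rewrite /circle_open preimage_setT; exact: openT. Qed.

Let circle_openI : setI_closed circle_open.
Proof. by move=> U V; exact: openI. Qed.

Let circle_open_bigcup (I : Type) (U : I -> set circle) :
  (forall i, circle_open (U i)) -> circle_open (\bigcup_i U i).
Proof. by move=> oU; apply: bigcup_open => i _; exact: oU. Qed.

HB.instance Definition _ := isOpenTopological.Build circle
  circle_openT circle_openI circle_open_bigcup.
HB.instance Definition _ := isPointed.Build circle 0.

HB.instance Definition _ := Measurable.copy circle
  (g_sigma_algebraType (@open circle)).

Lemma toCircleD (s t : R) : toCircle (s + t) = toCircle s + toCircle t.
Proof. by rewrite /toCircle piE. Qed.

Lemma toCircle_eq (s t : R) :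
  toCircle s = toCircle t <-> exists m : int, s - t = m%:~R.
Proof.
split=> [/eqP|].
  by rewrite /toCircle -Quotient.idealrBE => /Num.Theory.intrP.
by move=> /Num.Theory.intrP st; apply/eqP; rewrite /toCircle -Quotient.idealrBE.
Qed.

End Circle.

Section Arcs.
Variable R : realType.

(* A topological ball of the circle around [z]: the injective image of a bounded
   open interval (hence [b - a <= 1]) containing a lift [c] of [z]. The point [z]
   need not be the midpoint. *)
Definition open_arc_around (z : circle R) (A : set (circle R)) : Prop :=
  exists a b c : R, [/\ toCircle c = z, a < c < b, b - a <= 1 &
    A = [set toCircle t | t in `]a, b[%classic]].

End Arcs.

Section RandomRotation.
Variable R : realType.
Implicit Types (alpha eps : R) (x : circle R).

Definition rotation alpha x : circle R := x + toCircle alpha.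

Definition perturbed_rotation alpha (w : R) x : circle R :=
  rotation alpha x + toCircle w.

(* The noise [omega_i] is [w i.-1], for [i >= 1]. *)
Fixpoint random_orbit alpha (w : nat -> R) (n : nat) x : circle R :=
  if n is m.+1 then perturbed_rotation alpha (w m) (random_orbit alpha w m x)
  else x.

Lemma noise_itv eps : 0 < eps -> - eps < eps.
Proof. by move=> eps0; rewrite gtrN. Qed.

Definition noise_law eps (eps0 : 0 < eps) : probability (measurableTypeR R) R :=
  uniform_prob (noise_itv eps0).

(* [L^infinity] is read as the bounded Borel functions, so that the condition
   does not depend on a reference measure. *)
Definition is_stationary alpha eps (eps0 : 0 < eps)
    (mu : probability (circle R) R) : Prop :=
  forall psi : circle R -> R, measurable_fun setT psi ->
    (exists K : R, forall x, `|psi x| <= K) ->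
  (\int[noise_law eps0]_w \int[mu]_x (psi (perturbed_rotation alpha w x))%:E
   = \int[mu]_x (psi x)%:E)%E.

End RandomRotation.

Section Independence.
Context d (T : measurableType d) (R : realType) (P : probability T R).

Definition mutually_independent (I : eqType) (F : I -> set_system T) : Prop :=
  forall (J : seq I) (A : I -> set T), uniq J ->
    (forall i, i \in J -> F i (A i)) ->
  (P (\big[setI/setT]_(i <- J) A i) = \prod_(i <- J) P (A i))%E.

Context d' (S : measurableType d').

(* The sigma-algebras generated by the initial point ([None]) and by each
   noise variable ([Some i]). *)
Definition input_sigma_algebra (x0 : {RV P >-> S}) (w : nat -> {RV P >-> R})
    (i : option nat) : set_system T :=
  if i is Some j then g_sigma_algebra_preimage (w j)
  else g_sigma_algebra_preimage x0.

(* [(x0, w_0, w_1, ...)] has joint law [mu * nu^N]. *)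
Definition has_product_law (mu : probability S R) (nu : probability (measurableTypeR R) R)
    (x0 : {RV P >-> S}) (w : nat -> {RV P >-> R}) : Prop :=
  [/\ forall A, measurable A -> distribution P x0 A = mu A,
      forall i A, measurable A -> distribution P (w i) A = nu A &
      mutually_independent (input_sigma_algebra x0 w)].

End Independence.

Section ExtremeValues.
Context d (T : measurableType d) (R : realType) (P : probability T R).
Implicit Types (X : nat -> T -> \bar R) (u : nat -> R).

(* The maximum of [X_t, ..., X_(t + l - 1)], with value [-oo] when [l = 0]. *)
Definition block_max X (t l : nat) (s : T) : \bar R :=
  \big[maxe/-oo%E]_(t <= j < t + l) X j s.

Definition partial_max X (n : nat) : T -> \bar R := block_max X 0 n.

Definition little_o_n (t : nat -> nat) : Prop :=
  (t n)%:R / n%:R @[n --> \oo] --> (0 : R).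

(* The sequence [t_] is exposed because condition D' refers to it. *)
Definition cond_D2 X u (t_ : nat -> nat) : Prop :=
  little_o_n t_ /\
  exists gamma : nat -> nat -> R,
  [/\ forall l t n : nat,
        (`| P [set s | (u n)%:E < X 0%N s /\ block_max X t l s <= (u n)%:E]
          - P [set s | (u n)%:E < X 0%N s]
            * P [set s | partial_max X l s <= (u n)%:E] |
         <= (gamma n t)%:E)%E,
      forall n (t t' : nat), (t <= t')%N -> gamma n t' <= gamma n t &
      n%:R * gamma n (t_ n) @[n --> \oo] --> (0 : R)].

Definition cond_D' X u (t_ : nat -> nat) : Prop :=
  exists k : nat -> nat,
  [/\ k n @[n --> \oo] --> \oo,
      little_o_n (fun n => k n * t_ n)%N &
      (n%:R%:E * \sum_(1 <= j < (n %/ k n).+1)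
         P [set s | (u n)%:E < X 0%N s /\ (u n)%:E < X j s]
       @[n --> \oo] --> 0)%E].

Definition normalizing_levels X (tau : R) u : Prop :=
  (n%:R%:E * P [set s | (u n)%:E < X 0%N s] @[n --> \oo] --> tau%:E)%E.

Definition max_law_converges X u (l : R) : Prop :=
  (P [set s | partial_max X n s <= (u n)%:E] @[n --> \oo] --> l%:E)%E.

Definition degenerate (H : R -> R) : Prop :=
  exists a : R, forall y, H y = (a <= y)%R%:R.

Definition extreme_value_law X (H : cumulativeBounded (0 : R) (1 : R)) : Prop :=
  [/\ ~ degenerate H, H 0 = 0 &
      forall tau : R, 0 < tau -> exists u,
        normalizing_levels X tau u /\
        ({for tau, continuous H} -> max_law_converges X u (1 - H tau))].

Definition evl_with_extremal_index X (theta : R) : Prop :=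
  0 <= theta <= 1 /\
  exists H : cumulativeBounded (0 : R) (1 : R),
    extreme_value_law X H /\
    forall tau : R, 0 < tau -> 1 - H tau = expR (- theta * tau).

End ExtremeValues.

(* Main.v *)
From HB Require Import structures.
Require Import Defs.
From mathcomp Require Import all_boot all_order all_algebra.
From mathcomp Require Import all_classical all_reals all_analysis.
From mathcomp Require Import measurable_realfun.
From mathcomp Require Import ring lra.

(* Write [Q g x] for the expectation of [g (x + alpha + w)], with [w] uniform on
   [[-eps, eps]]. The density of [w + w'] is triangular, so it dominates a quarter
   of the density of [w] translated by at most [eps / 2]; chaining this estimate
   around the circle gives a Harnack inequality [c * Q g x <= Q^N g y], uniform in
   [x], [y] and [g >= 0]. It yields, for any stationary [mu], both [Q g <= mu(g) / c] and the exponential decay of the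
   oscillation of [Q^t g]. By the Markov property these are D' and D2 for the
   exceedances of an arbitrary measurable set [U].

   For the limit law let [p = mu(U)], let [g_l y] be the probability that the orbit
   of [y] avoids [U] at times [0, ..., l - 1], and let [a_l = mu(g_l)]. By
   stationarity [a_l - a_(l+1)] is the integral of [Q g_l] over [U], and [Q g_l] is
   within [O(rho(t) + t p)] of [a_l] uniformly: up to an error [O(t p)] the orbit
   can be ignored during its first [t] steps, after which it is nearly stationary.
   Hence [a_n = (1 - p)^n + O(n p (rho(t) + t p))], which tends to [exp (- tau)]
   when [n p] tends to [tau] and [t] goes to infinity more slowly than [n]. *)

Import Order.TTheory GRing.Theory Num.Theory.
Import numFieldNormedType.Exports.

Local Open Scope classical_set_scope.
Local Open Scope ring_scope.

Set Implicit Arguments.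
Unset Strict Implicit.
Unset Printing Implicit Defensive.

(** * Measurability on the circle *)

Section CircleMeasurability.
Variable R : realType.

(** A section of [toCircle] with values in [0, 1). Being Borel, it transfers measurability questions
    from the circle to the line; it also supplies the angle between two points. *)
Definition circle_lift (y : circle R) : R :=
  let t := repr y in t - (Num.floor t)%:~R.

Lemma circle_liftK y : toCircle (circle_lift y) = y.
Proof.
rewrite -[RHS]reprK; apply/toCircle_eq; exists (- Num.floor (repr y)).
by rewrite /circle_lift mulrNz addrAC subrr add0r.
Qed.

Lemma circle_lift_itv y : 0 <= circle_lift y < 1.
Proof.
rewrite /circle_lift; have := floor_itv (repr y).
by rewrite intrD; lra.
Qed.

Lemma toCircle_measurable : measurable_fun setT (@toCircle R : measurableTypeR R -> circle R).
Proof.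
apply: (@measurability _ _ _ _ _ _ (@open (circle R))) => //.
move=> _ [U oU <-]; rewrite setTI.
exact: open_measurable.
Qed.

Lemma circle_open_image_itv (a : R) : 0 <= a ->
  circle_open (@toCircle R @` `]a, 1[%classic : set (circle R)).
Proof.
move=> a0; rewrite /circle_open.
have -> : @toCircle R @^-1` (@toCircle R @` `]a, 1[%classic : set (circle R)) =
    \bigcup_(m : int) (`]a + m%:~R, 1 + m%:~R[%classic : set R).
  apply/seteqP; split => [t /= [s]|t [m _] /=]; rewrite !in_itv/=.
    move=> /andP[s1 s2] /toCircle_eq[m stm]; exists (- m) => //=.
    by rewrite in_itv/= mulrNz -stm; apply/andP; split; lra.
  move=> /andP[t1 t2]; exists (t - m%:~R).
    by rewrite in_itv/=; apply/andP; split; lra.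
  by apply/toCircle_eq; exists (- m); rewrite mulrNz; lra.
by apply: bigcup_open => m _; exact: interval_open.
Qed.

(** Rays generate the Borel sets of the line. Although the lift jumps at 0, the preimage of a ray
    starting at [a >= 0] is the open arc over []a, 1[], and for [a < 0] it is the whole circle. *)
Lemma circle_lift_measurable :
  measurable_fun setT (circle_lift : circle R -> measurableTypeR R).
Proof.
apply: (@measurability _ _ _ _ _ _ (@RGenOInfty.G R)).
  exact: RGenOInfty.measurableE.
move=> _ [_ [a ->] <-]; rewrite setTI.
have [a0|a0] := ltP a 0.
  rewrite (_ : _ @^-1` _ = setT); first exact: measurableT.
  apply/seteqP; split => // y _ /=; rewrite in_itv/= andbT.
  by have /andP[y0 _] := circle_lift_itv y; lra.
rewrite (_ : _ @^-1` _ = @toCircle R @` `]a, 1[%classic).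
  apply: sub_sigma_algebra; exact: circle_open_image_itv.
apply/seteqP; split => y /=.
  rewrite in_itv/= andbT => ay; exists (circle_lift y); last exact: circle_liftK.
  by rewrite in_itv/= ay; have /andP[] := circle_lift_itv y.
case=> t; rewrite in_itv/= => /andP[t1 t2] <-.
rewrite in_itv/= andbT.
(* [t] and the lift of its class both lie in [0, 1) and differ by an integer, so they coincide. *)
have /toCircle_eq[m tm] := circle_liftK (toCircle t).
have /andP[l0 l1] := circle_lift_itv (toCircle t).
have : (-1)%:~R < m%:~R :> R by rewrite -tm; lra.
have : m%:~R < 1%:~R :> R by rewrite -tm; lra.
rewrite !ltr_int => m1 m2.
have m0 : m = 0.
  by case: m m1 m2 {tm} => [[|?]|[|?]].
by move: tm; rewrite m0; lra.
Qed.

(** Joint measurability for the product sigma-algebra: lift, add on the line, project back. *)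
Lemma circle_add_measurable (alpha : R) :
  measurable_fun setT (fun p : circle R * measurableTypeR R =>
    perturbed_rotation alpha p.2 p.1).
Proof.
rewrite (_ : (fun p => _) = (@toCircle R : measurableTypeR R -> circle R) \o
   (fun p : circle R * measurableTypeR R => circle_lift p.1 + alpha + p.2)).
  apply: measurableT_comp; first exact: toCircle_measurable.
  apply: measurable_funD; last exact: measurable_snd.
  apply: measurable_funD; last exact: measurable_cst.
  by apply: measurableT_comp; [exact: circle_lift_measurable|exact: measurable_fst].
apply/funext => -[y r] /=; rewrite /perturbed_rotation /rotation.
rewrite (toCircleD (circle_lift y + alpha)) toCircleD circle_liftK. by [].
Qed.

End CircleMeasurability.

(** * The uniform noise and its convolution square *)

Section LebesgueTranslation.
Variable R : realType.
Local Notation leb := (@lebesgue_measure R).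

Let addl_measurable (a : R) :
  measurable_fun setT (+%R a : measurableTypeR R -> measurableTypeR R).
Proof. by apply: measurable_funD => //; exact: measurable_cst. Qed.

Lemma lebesgue_measureDl (a : R) (A : set R) : measurable A ->
  pushforward leb (+%R a : measurableTypeR R -> measurableTypeR R) A = leb A.
Proof.
move=> mA; apply/esym.
pose f : {mfun measurableTypeR R >-> measurableTypeR R} :=
  HB.pack (+%R a : measurableTypeR R -> measurableTypeR R)
    (isMeasurableFun.Build _ _ _ _ _ (addl_measurable a)).
apply: (@lebesgue_measure_unique R (pushforward leb f)) => //= _ [[b c] _ <-].
rewrite /pushforward/= (_ : (+%R a) @^-1` _ = `]b - a, c - a]%classic).
  rewrite !lebesgue_measure_itv/= !lte_fin ltrD2r.
  by case: ifPn => // _; rewrite -EFinB -EFinB; congr EFin; lra.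
apply/seteqP; split => x /=; rewrite !in_itv/= => /andP[? ?];
  by apply/andP; split; lra.
Qed.

Lemma ge0_integral_addl (a : R) (f : R -> \bar R) : measurable_fun setT f ->
  (forall x, 0 <= f x)%E ->
  (\int[leb]_x f (a + x)%R = \int[leb]_x f x)%E.
Proof.
move=> mf f0.
transitivity (\int[pushforward leb
   (+%R a : measurableTypeR R -> measurableTypeR R)]_x f x)%E.
  by rewrite ge0_integral_pushforward//=; exact: addl_measurable.
by apply: eq_measure_integral => //= A mA _; exact: lebesgue_measureDl.
Qed.

End LebesgueTranslation.

Section UniformNoise.
Variables (R : realType) (eps : R) (eps0 : 0 < eps).
Local Notation leb := (@lebesgue_measure R).
Local Notation nu := (noise_law eps0).

Definition noise_pdf (s : R) : R := (2 * eps)^-1 * \1_`[- eps, eps]%classic s.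

Lemma noise_pdf_ge0 s : 0 <= noise_pdf s.
Proof. by rewrite mulr_ge0// invr_ge0 mulr_ge0// ltW. Qed.

Lemma noise_pdf_measurable : measurable_fun setT noise_pdf.
Proof.
apply: measurable_funM; first exact: measurable_cst.
by apply: measurable_indic; exact: measurable_itv.
Qed.

Lemma noise_pdfE s : noise_pdf s = if `|s| <= eps then (2 * eps)^-1 else 0.
Proof.
rewrite /noise_pdf indicE mem_setE in_itv/= -ler_norml.
by case: ifP; rewrite ?mulr1 ?mulr0.
Qed.

Lemma ge0_integral_noise (h : R -> \bar R) : measurable_fun setT h ->
  (forall x, 0 <= h x)%E ->
  (\int[nu]_w h w = \int[leb]_s ((noise_pdf s)%:E * h s))%E.
Proof.
have e0 := eps0; move=> mh h0; rewrite /noise_law integral_uniform// opprK.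
rewrite integral_mkcond epatch_indic -ge0_integralZl//.
- apply: eq_integral => s _; rewrite /noise_pdf EFinM muleCA muleC -muleA.
  by rewrite -muleA mulrDl mul1r.
- apply: emeasurable_funM => //; apply/measurable_EFinP.
  by apply: measurable_indic; exact: measurable_itv.
- by move=> x _; rewrite mule_ge0// lee_fin.
- by rewrite lee_fin invr_ge0; lra.
Qed.

(* The convolution square of the uniform density is triangular, hence bounded
   below on a neighbourhood of [[-eps, eps]]. *)
Lemma noise_pdf_conv_ge (delta s : R) : `|delta| <= eps / 2 ->
  ((4^-1 * noise_pdf (s - delta))%:E <=
   \int[leb]_v ((noise_pdf v)%:E * (noise_pdf (s - v))%:E))%E.
Proof.
have e0 := eps0; move=> hd.
have mpdf : measurable_fun setT (fun v : R => (noise_pdf (s - v))%:E).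
  apply/measurable_EFinP.
  apply: (measurableT_comp noise_pdf_measurable).
  by apply: measurable_funB => //; exact: measurable_cst.
rewrite noise_pdfE; case: ifPn => [sd|_]; last first.
  by rewrite mulr0 integral_ge0// => v _; rewrite mule_ge0// lee_fin noise_pdf_ge0.
(* [J] is the overlap of [[-eps, eps]] with its translate by [s]. As [|s| <= 3 * eps / 2], its
   length [2 * eps - |s|] is at least [eps / 2]. *)
set J := if 0 <= s then `[s - eps, eps] else `[- eps, s + eps].
have JI v : v \in J -> `|v| <= eps /\ `|s - v| <= eps.
  by rewrite /J; move: hd sd; rewrite !ler_norml; case: ifPn => s0;
    rewrite in_itv/= => /andP[? ?] /andP[? ?] /andP[? ?]; lra.
apply: (@le_trans _ _ (\int[leb]_v (((2 * eps)^-1 ^+ 2)%:E * (\1_[set` J] v)%:E))%E).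
  rewrite ge0_integralZl//=; last 2 first.
  - apply/measurable_EFinP; apply: measurable_indic; exact: measurable_itv.
  - by rewrite lee_fin exprn_ge0// invr_ge0; lra.
  rewrite integral_indic//= setIT.
  (* The factor 1/4 comes from [(2 * eps)^-2 * (eps / 2) = 4^-1 * (2 * eps)^-1]. *)
  apply: (@le_trans _ _ (((2 * eps)^-1 ^+ 2)%:E * (eps / 2)%:E)%E).
    rewrite -EFinM lee_fin le_eqVlt; apply/orP; left; apply/eqP.
    by field; rewrite gt_eqF.
  apply: lee_wpmul2l; first by rewrite lee_fin exprn_ge0// invr_ge0; lra.
  move: hd sd; rewrite !ler_norml => /andP[? ?] /andP[? ?].
  rewrite /J; case: (boolP (0 <= s)) => s0; rewrite lebesgue_measure_itv/= lte_fin ifT;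
    rewrite -?EFinB ?lee_fin; lra.
apply: ge0_le_integral => //.
- by move=> v _; rewrite -EFinM lee_fin mulr_ge0// exprn_ge0// invr_ge0; lra.
- apply: emeasurable_funM; first exact: measurable_cst.
  apply/measurable_EFinP; apply: measurable_indic; exact: measurable_itv.
- by apply: emeasurable_funM => //; apply/measurable_EFinP; exact: noise_pdf_measurable.
- move=> v _; rewrite -!EFinM lee_fin indicE mem_setE.
  case: (boolP (v \in J)) => [/JI[v1 v2]|_]; last first.
    by rewrite mulr0 mulr_ge0// noise_pdf_ge0.
  by rewrite !noise_pdfE v1 v2 mulr1 expr2.
Qed.

(** The pointwise density bound integrated against [h]: translation invariance and Tonelli write
    both sides as Lebesgue integrals of [h] times a density. *)
Lemma noise_conv_ge (h : R -> \bar R) (delta : R) : measurable_fun setT h ->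
  (forall x, 0 <= h x)%E -> `|delta| <= eps / 2 ->
  ((4^-1)%:E * \int[nu]_w h (delta + w)%R <=
   \int[nu]_v \int[nu]_w h (v + w)%R)%E.
Proof.
move=> mh h0 hd.
have mD : measurable_fun setT (fun p : R * R => p.1 + p.2).
  exact: measurable_funD.
have mB : measurable_fun setT (fun p : R * R => p.2 - p.1).
  exact: measurable_funB.
have mhD a : measurable_fun setT (fun w : R => h (a + w)%R).
  apply: (measurableT_comp mh).
  by apply: measurable_funD => //; exact: measurable_cst.
have shift a : (\int[nu]_w h (a + w)%R = \int[leb]_s ((noise_pdf (s - a))%:E * h s))%E.
  rewrite ge0_integral_noise//.
  rewrite -(@ge0_integral_addl _ a (fun s => (noise_pdf (s - a))%:E * h s)%E).
  - by apply: eq_integral => s _; rewrite (_ : (a + s - a)%R = s)//; lra.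
  - apply: emeasurable_funM => //; apply/measurable_EFinP.
    apply: (measurableT_comp noise_pdf_measurable).
    by apply: measurable_funB => //; exact: measurable_cst.
  - by move=> x; rewrite mule_ge0// lee_fin noise_pdf_ge0.
have mk : measurable_fun setT (fun p : R * R =>
    ((noise_pdf p.1)%:E * ((noise_pdf (p.2 - p.1))%:E * h p.2))%E).
  apply: emeasurable_funM.
    by apply/measurable_EFinP; apply: (measurableT_comp noise_pdf_measurable).
  apply: emeasurable_funM; last exact: measurableT_comp.
  by apply/measurable_EFinP; exact: (measurableT_comp noise_pdf_measurable).
have k0 (p : R * R) : (0 <= (noise_pdf p.1)%:E * ((noise_pdf (p.2 - p.1))%:E * h p.2))%E.
  by rewrite !mule_ge0// lee_fin noise_pdf_ge0.
have mpdf a : measurable_fun setT (fun s : R => (noise_pdf (s - a))%:E).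
  apply/measurable_EFinP.
  apply: (measurableT_comp noise_pdf_measurable).
  by apply: measurable_funB => //; exact: measurable_cst.
have mpdf' a : measurable_fun setT (fun s : R => (noise_pdf (a - s))%:E).
  apply/measurable_EFinP.
  apply: (measurableT_comp noise_pdf_measurable).
  by apply: measurable_funB => //; exact: measurable_cst.
have mph a : measurable_fun setT (fun s : R => ((noise_pdf (s - a))%:E * h s)%E).
  by apply: emeasurable_funM; [exact: mpdf|exact: mh].
rewrite [leRHS](_ : _ = \int[leb]_s \int[leb]_v
    ((noise_pdf v)%:E * ((noise_pdf (s - v))%:E * h s)))%E; last first.
  transitivity (\int[leb]_v \int[leb]_s
      ((noise_pdf v)%:E * ((noise_pdf (s - v))%:E * h s)))%E; last first.
    exact: (@fubini_tonelli _ _ _ _ _ leb leb (fun p : R * R =>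
      ((noise_pdf p.1)%:E * ((noise_pdf (p.2 - p.1))%:E * h p.2))%E) mk k0).
  rewrite ge0_integral_noise; last 2 first.
  - exact: (@measurable_fun_fubini_tonelli_F _ _ _ _ _ nu (fun p : R * R => h (p.1 + p.2)%R)
      (measurableT_comp mh mD) (fun p => h0 (p.1 + p.2)%R)).
  - by move=> x; exact: integral_ge0.
  apply: eq_integral => v _; rewrite shift ge0_integralZl//.
  - exact: mph.
  - by move=> s _; rewrite mule_ge0// lee_fin noise_pdf_ge0.
  - by rewrite lee_fin noise_pdf_ge0.
rewrite shift -ge0_integralZl//; last 2 first.
- exact: mph.
- by move=> s _; rewrite mule_ge0// lee_fin noise_pdf_ge0.
apply: ge0_le_integral => //.
- by move=> s _; rewrite !mule_ge0// lee_fin noise_pdf_ge0.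
- by apply: emeasurable_funM; [exact: measurable_cst|exact: mph].
- exact: (@measurable_fun_fubini_tonelli_G _ _ _ _ _ leb (fun p : R * R =>
    ((noise_pdf p.1)%:E * ((noise_pdf (p.2 - p.1))%:E * h p.2))%E) mk k0).
move=> s _.
rewrite [leRHS](_ : _ =
    \int[leb]_v ((noise_pdf v)%:E * (noise_pdf (s - v))%:E) * h s)%E; last first.
  rewrite -ge0_integralZr//.
  - by apply: eq_integral => v _; rewrite muleA.
  - have mpp : measurable_fun setT
        (fun v : R => ((noise_pdf v)%:E * (noise_pdf (s - v))%:E)%E).
      apply: emeasurable_funM; last exact: mpdf'.
      by apply/measurable_EFinP; exact: noise_pdf_measurable.
    exact: mpp.
  - by move=> v _; rewrite mule_ge0// lee_fin noise_pdf_ge0.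
rewrite muleA -EFinM; apply: lee_wpmul2r => //.
exact: noise_pdf_conv_ge.
Qed.

End UniformNoise.

(** * The transition operator *)

Section BoundedMeasurable.
Context d (T : measurableType d) (R : realType).

(** Nonnegativity gives Tonelli, and boundedness makes real and extended integrals interchangeable.
    The transition operator preserves this class. *)
Definition bounded_ge0 (g : T -> R) : Prop :=
  measurable_fun setT g /\ exists K, forall x, 0 <= g x <= K.

Lemma bounded_ge0_ge0 g x : bounded_ge0 g -> 0 <= g x.
Proof. by case=> _ [K /(_ x)/andP[]]. Qed.

Lemma bounded_ge0_cst (a : R) : 0 <= a -> bounded_ge0 (fun=> a).
Proof. by move=> a0; split; [exact: measurable_cst|exists a => y; rewrite a0 lexx]. Qed.

Lemma bounded_ge0_indicM (A : set T) g : measurable A -> bounded_ge0 g ->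
  bounded_ge0 (fun x => \1_A x * g x : R).
Proof.
move=> mA bg; split.
  by apply: measurable_funM; [exact: measurable_indic|exact: bg.1].
have [_ [K gK]] := bg; exists K => y; have /andP[g0 gK'] := gK y.
by rewrite indicE; case: (_ \in _); rewrite ?mul1r ?mul0r ?g0 ?lexx /= ?(le_trans g0).
Qed.

Lemma bounded_ge0_indic (A : set T) : measurable A -> bounded_ge0 (\1_A : T -> R).
Proof.
move=> mA; split; first exact: measurable_indic.
by exists 1 => x; rewrite indicE; case: (_ \in _); rewrite ?ler01 ?lexx.
Qed.

Variable P : probability T R.

Lemma Rintegral_probability_cst (a : R) : \int[P]_x (fun=> a) x = a.
Proof.
rewrite Rintegral_cst// -[RHS]mulr1; congr (_ * _).
exact: (congr1 fine (probability_setT P)).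
Qed.

Lemma bounded_ge0_integrable g : bounded_ge0 g -> P.-integrable setT (EFin \o g).
Proof.
move=> [mg [K gK]]; apply: measurable_bounded_integrable => //.
  by rewrite (le_lt_trans (probability_le1 _ _))// ltry.
exists K; split; first exact: num_real.
move=> M KM x _; have /andP[g0 g1] := gK x.
by rewrite /= ger0_norm// (le_trans g1)// ltW.
Qed.

Lemma bounded_ge0_EFin_Rintegral g : bounded_ge0 g ->
  (\int[P]_x g x)%:E = (\int[P]_x (g x)%:E)%E.
Proof.
move=> bg; rewrite fineK//.
exact: integrable_fin_num (bounded_ge0_integrable bg).
Qed.

Lemma Rintegral_affine g (a b : R) : bounded_ge0 g ->
  \int[P]_x (a + b * g x) = a + b * \int[P]_x g x.
Proof.
move=> bg; have ig := bounded_ge0_integrable bg.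
rewrite RintegralD//; last exact: (integrableZl _ b ig).
  by rewrite RintegralZl// Rintegral_probability_cst.
exact: finite_measure_integrable_cst.
Qed.

Lemma bounded_ge0_Rintegral_le g h : bounded_ge0 g -> bounded_ge0 h ->
  (forall x, g x <= h x) -> \int[P]_x g x <= \int[P]_x h x.
Proof. by move=> bg bh gh; apply: le_Rintegral => //; exact: bounded_ge0_integrable. Qed.

End BoundedMeasurable.

Section TransitionOperator.
Variables (R : realType) (alpha eps : R) (eps0 : 0 < eps).
Local Notation nu := (noise_law eps0).
Local Notation f_ := (@perturbed_rotation R alpha).
Implicit Types (g : circle R -> R) (x y : circle R).

Definition transition g x : R := \int[nu]_w g (f_ w x).
Local Notation Q := transition.

Lemma bounded_ge0_noise g x : bounded_ge0 g ->
  bounded_ge0 (fun w : R => g (f_ w x)).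
Proof.
move=> [mg [K gK]]; split; last by exists K.
apply: (measurableT_comp mg).
exact: (measurableT_comp (circle_add_measurable alpha) (measurable_pair1 x)).
Qed.

Lemma EFin_transition g x : bounded_ge0 g ->
  (Q g x)%:E = (\int[nu]_w (g (f_ w x))%:E)%E.
Proof. by move=> bg; apply/bounded_ge0_EFin_Rintegral/bounded_ge0_noise. Qed.

Lemma transition_affine g (a b : R) x : bounded_ge0 g ->
  Q (fun y => a + b * g y) x = a + b * Q g x.
Proof. by move=> bg; rewrite /Q Rintegral_affine//; exact: bounded_ge0_noise. Qed.

Lemma transition_cst (a : R) x : Q (fun=> a) x = a.
Proof.
rewrite -[RHS]addr0 -[in RHS](mul0r (Q (fun=> 0) x)) -transition_affine; last exact: bounded_ge0_cst.
by apply: eq_Rintegral => w _; rewrite mulr0 addr0.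
Qed.

Lemma transition_le g h x : bounded_ge0 g -> bounded_ge0 h ->
  (forall y, g y <= h y) -> Q g x <= Q h x.
Proof.
by move=> bg bh gh; apply: bounded_ge0_Rintegral_le => //;
  exact: bounded_ge0_noise.
Qed.

Lemma transition_bounded_ge0 g : bounded_ge0 g -> bounded_ge0 (Q g).
Proof.
move=> bg; have [mg [K gK]] := bg; split.
  apply: (measurableT_comp (fine_measurable measurableT)).
  apply: (@measurable_fun_fubini_tonelli_F _ _ _ _ _ nu
    (fun p : circle R * measurableTypeR R => (g (f_ p.2 p.1))%:E)).
    by apply/measurable_EFinP; exact: (measurableT_comp mg (circle_add_measurable alpha)).
  by move=> p; rewrite lee_fin; exact: bounded_ge0_ge0.
have K0 : 0 <= K by have /andP[/le_trans] := gK 0; apply.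
exists K => x; apply/andP; split.
  by apply: Rintegral_ge0 => w _; exact: bounded_ge0_ge0.
rewrite -[leRHS](transition_cst K x).
by apply: transition_le => //; [exact: bounded_ge0_cst|move=> y; have /andP[] := gK y].
Qed.

Lemma iter_transition_bounded_ge0 n g : bounded_ge0 g -> bounded_ge0 (iter n Q g).
Proof. by move=> bg; elim: n => //= n; exact: transition_bounded_ge0. Qed.

Lemma iter_transition_affine n g (a b : R) : bounded_ge0 g ->
  bounded_ge0 (fun y => a + b * g y) ->
  iter n Q (fun y => a + b * g y) = (fun x => a + b * iter n Q g x).
Proof.
move=> bg bab; elim: n => //= n ->; apply/funext => x.
by rewrite transition_affine//; exact: iter_transition_bounded_ge0.
Qed.

(** This is [noise_conv_ge] for [s => g (y + 2 alpha + s)]: one step from the displaced point and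
    two steps from [y] involve the same total rotation. *)
Lemma transition_step g y (delta : R) : bounded_ge0 g -> `|delta| <= eps / 2 ->
  4^-1 * Q g (y + toCircle (alpha + delta)) <= Q (Q g) y.
Proof.
move=> bg hd; rewrite -lee_fin EFinM EFin_transition//.
rewrite EFin_transition; last exact: transition_bounded_ge0.
pose h s := (g (y + toCircle (alpha + alpha + s)))%:E.
have mh : measurable_fun setT h.
  apply/measurable_EFinP; apply: (measurableT_comp bg.1).
  rewrite (_ : (fun s => _) = fun s => f_ s (y + toCircle alpha)).
    exact: (measurableT_comp (circle_add_measurable alpha) (measurable_pair1 _)).
  by apply/funext => s; rewrite /perturbed_rotation /rotation !toCircleD !addrA.
have h0 s : (0 <= h s)%E by rewrite lee_fin; exact: bounded_ge0_ge0.
have := noise_conv_ge eps0 mh h0 hd; congr (_ * _ <= _)%E.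
  apply: eq_integral => w _; rewrite /h; congr (g _)%:E.
  rewrite /perturbed_rotation /rotation !toCircleD; rewrite -!addrA; congr (_ + _).
  congr (_ + _); exact: addrCA.
apply: eq_integral => v _; rewrite EFin_transition//.
apply: eq_integral => w _; rewrite /h; congr (g _)%:E.
rewrite /perturbed_rotation /rotation !toCircleD; rewrite -!addrA; congr (_ + _).
by congr (_ + _); exact: addrCA.
Qed.

(** The displacement is cut into equal pieces of size at most [eps / 2]; each costs one more iterate
    and a factor 1/4. *)
Lemma transition_chain k g y (delta : R) : bounded_ge0 g ->
  `|delta| <= k%:R * (eps / 2) ->
  4^-1 ^+ k * Q g (y + toCircle (k%:R * alpha + delta)) <= iter k.+1 Q g y.
Proof.
move=> bg; elim: k y delta => [|k IH] y delta hd.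
  move: hd; rewrite mul0r normr_le0 => /eqP ->.
  have t0 : toCircle 0 = 0 :> circle R.
    by apply: (addrI (toCircle 0)); rewrite -toCircleD !addr0.
  by rewrite expr0 mul1r mul0r addr0 t0 addr0.
pose d1 := delta / k.+1%:R.
have k0 : (0 : R) < k.+1%:R by rewrite ltr0n.
have hd1 : `|d1| <= eps / 2.
  by rewrite normrM normfV (gtr0_norm k0) ler_pdivrMr// mulrC.
have hd2 : `|k%:R * d1| <= k%:R * (eps / 2).
  by rewrite normrM ger0_norm// ler_wpM2l.
have := transition_step y (iter_transition_bounded_ge0 k bg) hd1.
apply: le_trans.
rewrite exprS -mulrA ler_pM2l; last by rewrite invr_gt0.
apply: le_trans (IH _ _ hd2).
rewrite le_eqVlt; apply/orP; left; apply/eqP.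
congr (_ * Q g _); rewrite -addrA -toCircleD; congr (_ + toCircle _).
rewrite (_ : delta = k.+1%:R * d1); first by rewrite -natr1; ring.
by rewrite /d1 mulrC divfK// gt_eqF.
Qed.

Lemma transition_harnack : exists N (c : R), [/\ (0 < N)%N, 0 < c <= 1 &
  forall g, bounded_ge0 g -> forall x y, c * Q g x <= iter N Q g y].
Proof.
have e0 := eps0.
(* With this many pieces of size [eps / 2] the total displacement can reach a full turn, hence any
   point of the circle. *)
pose k := (Num.truncn (2 / eps)).+1.
have hk : 1 <= k%:R * (eps / 2).
  have := truncnS_gt (2 / eps); rewrite ltr_pdivrMr// => h.
  by rewrite /k; lra.
exists k.+1, (4^-1 ^+ k); split => //.
  by rewrite exprn_gt0/=; [rewrite exprn_ile1//; lra|lra].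
move=> g bg x y; pose delta := circle_lift (x - y - toCircle (k%:R * alpha)).
have hd : `|delta| <= k%:R * (eps / 2).
  have /andP[d0 d1] := circle_lift_itv (x - y - toCircle (k%:R * alpha)).
  by rewrite ger0_norm// (le_trans (ltW d1)).
have := @transition_chain k g y delta bg hd.
by rewrite toCircleD circle_liftK (addrC (toCircle _)) subrK addrC subrK.
Qed.

End TransitionOperator.

(** * Mixing *)

Section Mixing.
Variables (R : realType) (alpha eps : R) (eps0 : 0 < eps).
Local Notation nu := (noise_law eps0).
Local Notation f_ := (@perturbed_rotation R alpha).
Local Notation Q := (transition alpha eps0).
Implicit Types (g : circle R -> R) (x y : circle R).

Lemma bounded_ge0_between g a b : measurable_fun setT g ->
  (forall x, a <= g x <= b) -> 0 <= a -> bounded_ge0 g.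
Proof.
move=> mg gab a0; split => //; exists b => x.
by have /andP[ga ->] := gab x; rewrite (le_trans a0 ga).
Qed.

(** The number [a] is the infimum of [g]; its sign keeps the constants [a] and [a + r] among the
    functions [bounded_ge0]. *)
Lemma range_itv_of_oscillation g r : bounded_ge0 g ->
  (forall x y, g x - g y <= r) -> exists2 a, 0 <= a & forall x, a <= g x <= a + r.
Proof.
move=> bg osc; have g0 x := bounded_ge0_ge0 x bg.
have inf_g : has_inf (range g).
  by split; [exists (g 0), 0|exists 0 => _ [x _ <-]].
exists (inf (range g)).
  by apply: lb_le_inf => [|_ [x _ <-]]; [exists (g 0), 0|].
move=> x; apply/andP; split; first by apply: ge_inf; [exact: inf_g.2|exists x].
rewrite -lerBlDr; apply: lb_le_inf; first by exists (g 0), 0.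
by move=> _ [y _ <-]; rewrite lerBlDr -lerBlDl.
Qed.

Lemma transition_oscillation g r : bounded_ge0 g ->
  (forall x y, g x - g y <= r) -> forall x y, Q g x - Q g y <= r.
Proof.
move=> bg osc x y; have [a a0 ga] := range_itv_of_oscillation bg osc.
have r0 : 0 <= r by rewrite -(subrr (g 0)).
have Qx : Q g x <= a + r.
  rewrite -[leRHS](transition_cst alpha eps0 (a + r) x).
  apply: transition_le => // [|z]; last by have /andP[] := ga z.
  by apply: bounded_ge0_cst; rewrite addr_ge0.
have Qy : a <= Q g y.
  rewrite -[leLHS](transition_cst alpha eps0 a y).
  by apply: transition_le => // [|z]; [exact: bounded_ge0_cst|have /andP[] := ga z].
lra.
Qed.

Lemma iter_transition_oscillation n g r : bounded_ge0 g ->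
  (forall x y, g x - g y <= r) -> forall x y, iter n Q g x - iter n Q g y <= r.
Proof.
move=> bg osc; elim: n => //= n IH.
by apply: transition_oscillation => //; exact: iter_transition_bounded_ge0.
Qed.

(** Doeblin's argument. If [g] takes values in [[a, a + r]], apply the Harnack bound to [g - a] at
    [y] and to [a + r - g] at [x], with the same reference point 0. In the sum the values [Q g 0]
    cancel and [c * r] is gained. *)
Lemma oscillation_contraction N (c : R) :
  (forall g, bounded_ge0 g -> forall x y, c * Q g x <= iter N Q g y) ->
  forall g r, bounded_ge0 g -> (forall x y, g x - g y <= r) ->
  forall x y, iter N Q g x - iter N Q g y <= (1 - c) * r.
Proof.
move=> harnack g r bg osc x y.
have [a a0 ga] := range_itv_of_oscillation bg osc.
have bl : bounded_ge0 (fun z => - a + 1 * g z).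
  apply: (@bounded_ge0_between _ 0 r) => // [|z].
    apply: measurable_funD; first exact: measurable_cst.
    by apply: measurable_funM; [exact: measurable_cst|exact: bg.1].
  by have /andP[? ?] := ga z; lra.
have bu : bounded_ge0 (fun z => (a + r) + (-1) * g z).
  apply: (@bounded_ge0_between _ 0 r) => // [|z].
    apply: measurable_funD; first exact: measurable_cst.
    by apply: measurable_funM; [exact: measurable_cst|exact: bg.1].
  by have /andP[? ?] := ga z; lra.
have := harnack _ bl 0 y; have := harnack _ bu 0 x.
rewrite !iter_transition_affine// !transition_affine//; lra.
Qed.

Lemma transition_mixing : exists rho : nat -> R,
  [/\ forall t t', (t <= t')%N -> rho t' <= rho t,
      rho t @[t --> \oo] --> (0 : R) &
      forall g, bounded_ge0 g -> (forall x, g x <= 1) ->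
      forall t x y, iter t Q g x - iter t Q g y <= rho t].
Proof.
have [N [c [N0 /andP[c0 c1] harnack]]] := transition_harnack alpha eps0.
have q0 : 0 <= 1 - c by lra.
have q1 : 1 - c <= 1 by lra.
(* One factor [1 - c] per complete block of [N] steps; the remaining [t %% N] steps do not increase
   the oscillation. *)
exists (fun t => (1 - c) ^+ (t %/ N)); split.
- move=> t t' tt'; rewrite ler_wiXn2l//.
  exact: leq_div2r.
- apply: (@cvg_comp _ _ _ (fun t => t %/ N)%N (fun m => (1 - c) ^+ m) _ \oo).
    move=> A [m _ Am]; exists (m * N)%N => // t /= mt.
    by apply: Am => /=; rewrite leq_divRL.
  by apply: cvg_expr; rewrite ger0_norm//; lra.
- move=> g bg g1 t x y.
  have osc m h r : bounded_ge0 h -> (forall x y, h x - h y <= r) ->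
      forall x y, iter (m * N) Q h x - iter (m * N) Q h y <= (1 - c) ^+ m * r.
    move=> bh hr; elim: m => [|m IH]; first by move=> ? ?; rewrite mul0n expr0 mul1r.
    move=> x' y'; rewrite mulSn iterD exprS -mulrA.
    apply: (oscillation_contraction harnack) => //.
    exact: iter_transition_bounded_ge0.
  rewrite [in iter t Q g x](divn_eq t N) [in iter t Q g y](divn_eq t N) !iterD -[leRHS]mulr1.
  apply: osc; first exact: iter_transition_bounded_ge0.
  apply: iter_transition_oscillation => // x' y'.
  by have := bounded_ge0_ge0 y' bg; have := g1 x'; lra.
Qed.

Variables (mu : probability (circle R) R) (mu_stationary : is_stationary alpha eps0 mu).

(** In [is_stationary] the noise is integrated last; Tonelli exchanges the order so that [Q]
    appears. *)
Lemma stationary_transition g : bounded_ge0 g ->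
  \int[mu]_x Q g x = \int[mu]_x g x.
Proof.
move=> bg; apply: EFin_inj.
rewrite !bounded_ge0_EFin_Rintegral//; last exact: transition_bounded_ge0.
rewrite -(mu_stationary bg.1); last first.
  have [_ [K gK]] := bg; exists K => x; have /andP[? ?] := gK x.
  by rewrite ger0_norm.
under eq_integral do rewrite EFin_transition//.
apply: (@fubini_tonelli _ _ _ _ _ mu nu
  (fun p : circle R * measurableTypeR R => (g (f_ p.2 p.1))%:E)).
  apply/measurable_EFinP.
  exact: (measurableT_comp bg.1 (circle_add_measurable alpha)).
by move=> p; rewrite lee_fin; exact: bounded_ge0_ge0.
Qed.

Lemma stationary_iter_transition n g : bounded_ge0 g ->
  \int[mu]_x iter n Q g x = \int[mu]_x g x.
Proof.
move=> bg; elim: n => //= n <-.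
by apply: stationary_transition; exact: iter_transition_bounded_ge0.
Qed.

(** Integrating the Harnack bound over [y] against [mu] gives [C = c^-1], since stationarity removes
    the [N] iterates. In effect the one-step law has density at most [C] with respect to [mu]. *)
Lemma transition_le_mean : exists2 C : R, 0 < C &
  forall g, bounded_ge0 g -> forall x, Q g x <= C * \int[mu]_y g y.
Proof.
have [N [c [N0 /andP[c0 c1] harnack]]] := transition_harnack alpha eps0.
exists c^-1; first by rewrite invr_gt0.
move=> g bg x; rewrite ler_pdivlMl// -(stationary_iter_transition N bg).
have cQ : 0 <= c * Q g x.
  by rewrite mulr_ge0// ?(ltW c0)//; apply/bounded_ge0_ge0/transition_bounded_ge0.
have -> : c * Q g x = \int[mu]_y (c * Q g x).
  by rewrite Rintegral_probability_cst.
apply: bounded_ge0_Rintegral_le; [exact: bounded_ge0_cst| |by move=> y; exact: harnack].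
exact: iter_transition_bounded_ge0.
Qed.

Lemma dist_mean_le_oscillation g r x : bounded_ge0 g ->
  (forall x y, g x - g y <= r) -> `|g x - \int[mu]_y g y| <= r.
Proof.
move=> bg osc; have r0 : 0 <= r by rewrite -(subrr (g 0)).
have [a a0 ga] := range_itv_of_oscillation bg osc.
have h1 : a <= \int[mu]_y g y.
  rewrite -[leLHS](Rintegral_probability_cst mu); apply: bounded_ge0_Rintegral_le => //.
    exact: bounded_ge0_cst.
  by move=> y; have /andP[] := ga y.
have h2 : \int[mu]_y g y <= a + r.
  rewrite -[leRHS](Rintegral_probability_cst mu); apply: bounded_ge0_Rintegral_le => //.
    by apply: bounded_ge0_cst; rewrite addr_ge0.
  by move=> y; have /andP[] := ga y.
have /andP[? ?] := ga x.
rewrite ler_norml; lra.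
Qed.

End Mixing.

(** * The Markov property *)

Section IndependentIntegral.
Context d (T : measurableType d) (R : realType) (P : probability T R).
Context d' (S : measurableType d') (G : set_system T) (W : {mfun T >-> S}).
Hypotheses (GI : setI_closed G) (Gm : G `<=` measurable).
Hypothesis G_indep : forall A B, G A -> measurable B ->
  P (A `&` W @^-1` B) = (P A * P (W @^-1` B))%E.
Local Notation TG := (g_sigma_algebraType G).

Lemma generated_measurable (A : set T) : <<s G >> A -> measurable A.
Proof.
apply: smallest_sub => //; split; [exact: measurable0| |].
  by move=> ? ?; exact: measurableD.
by move=> ? ?; exact: bigcupT_measurable.
Qed.

Lemma generated_indep A B : <<s G >> A -> measurable B ->
  P (A `&` W @^-1` B) = (P A * P (W @^-1` B))%E.
Proof.
move=> + mB; have mW : measurable (W @^-1` B).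
  by rewrite -[_ @^-1` _]setTI; exact: measurable_funP.
have [p pE] : exists p, P (W @^-1` B) = p%:E.
  by exists (fine (P (W @^-1` B))); rewrite fineK// fin_num_measure.
have compl (C : set T) : measurable C -> P (C `&` W @^-1` B) = (P C * p%:E)%E ->
    P (~` C `&` W @^-1` B) = (P (~` C) * p%:E)%E.
  move=> mS IH; rewrite probability_setC// muleBl// -IH mul1e -pE setIC -setDE.
  rewrite measureD//; first by rewrite setIC.
  by rewrite -ge0_fin_numE// fin_num_measure.
have bigc (F : (set T)^nat) : (forall n, measurable (F n)) -> trivIset setT F ->
    (forall n, P (F n `&` W @^-1` B) = (P (F n) * p%:E)%E) ->
    P (\bigcup_k F k `&` W @^-1` B) = (P (\bigcup_k F k) * p%:E)%E.
  move=> mF tF IH; rewrite setI_bigcupl !measure_bigcup//; last 2 first.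
  - by move=> n _; exact: measurableI.
  - exact: trivIset_setIr.
  rewrite [RHS]muleC -nneseriesZl//.
  apply: eq_eseriesr => n _. rewrite muleC; exact: IH.
rewrite pE; apply: (@dynkin_induction _ TG G
  (fun A => P (A `&` W @^-1` B) = (P A * p%:E)%E)) => //.
- have := probability_setT P; rewrite -pE setTI => PT.
  rewrite -[LHS]mul1e; congr (_ * _)%E; exact: esym PT.
- by move=> C GC; rewrite -pE; exact: G_indep.
- by move=> C /generated_measurable mS; exact: compl.
- by move=> F mF; apply: bigc => n; apply: generated_measurable; exact: mF.
Qed.

(** The freezing lemma. Independence says that the identity, seen as a map to the coarser space
    [TG], and [W] have a product joint law; Tonelli then averages over [W] with the first argument
    fixed. *)
Lemma integral_indep (f : TG * S -> \bar R) : measurable_fun setT f ->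
  (forall p, 0 <= f p)%E ->
  (\int[P]_s f (s : TG, W s) = \int[P]_s \int[distribution P W]_r f (s : TG, r))%E.
Proof.
move=> mf f0.
have mid : measurable_fun setT (idfun : T -> TG).
  by move=> _ A /generated_measurable; rewrite setTI.
pose idG : {mfun T >-> TG} :=
  HB.pack (idfun : T -> TG) (isMeasurableFun.Build _ _ _ _ _ mid).
have mphi : measurable_fun setT (fun s : T => (s : TG, W s)).
  by apply: measurable_fun_pair => //; exact: measurable_funP.
pose phi : {mfun T >-> (TG * S)%type} :=
  HB.pack (fun s : T => (s : TG, W s)) (isMeasurableFun.Build _ _ _ _ _ mphi).
transitivity (\int[pushforward P phi]_p f p)%E.
  by rewrite ge0_integral_pushforward.
transitivity (\int[(distribution P idG \x distribution P W)%E]_p f p)%E.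
  apply: eq_measure_integral => A mA _; apply/esym.
  apply: product_measure_unique => // B C mB mC.
  exact: generated_indep.
rewrite fubini_tonelli1//= ge0_integral_pushforward//.
  exact: measurable_fun_fubini_tonelli_F.
by move=> s _; exact: integral_ge0.
Qed.

End IndependentIntegral.

Section MarkovProperty.
Variables (R : realType) (alpha eps : R) (eps0 : 0 < eps).
Local Notation nu := (noise_law eps0).
Local Notation Q := (transition alpha eps0).
Variables (mu : probability (circle R) R).
Context d (T : measurableType d) (P : probability T R).
Variables (x0 : {RV P >-> circle R}) (w : nat -> {RV P >-> R}).
Hypothesis P_product : has_product_law mu nu x0 w.
Implicit Types (g : circle R -> R).

Definition orbit_at n (s : T) : circle R :=
  random_orbit alpha (fun i => w i s) n (x0 s).
Local Notation Y := orbit_at.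

Let inputs n : seq (option nat) := None :: map Some (iota 0 n).

(* A pi-system that generates the sigma-algebra of the initial point and the
   first [n] noises. *)
Definition past n : set_system T :=
  [set A | exists2 F : option nat -> set T,
    (forall i, input_sigma_algebra x0 w i (F i)) &
    A = \big[setI/setT]_(i <- inputs n) F i].

Let input_setT i : input_sigma_algebra x0 w i setT.
Proof. by case: i => [j|] /=; exists setT => //; rewrite setTI preimage_setT. Qed.

Let input_setI i A B : input_sigma_algebra x0 w i A ->
  input_sigma_algebra x0 w i B -> input_sigma_algebra x0 w i (A `&` B).
Proof.
by case: i => [j|] /= [A' mA' <-] [B' mB' <-]; exists (A' `&` B');
  rewrite ?setTI ?preimage_setI//; exact: measurableI.
Qed.

Let input_measurable i A : input_sigma_algebra x0 w i A -> measurable A.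
Proof. by case: i => [j|] /= [A' mA' <-]; exact: measurable_funP. Qed.

Let inputs_uniq n : uniq (inputs n).
Proof.
rewrite /= map_inj_uniq ?iota_uniq ?andbT; last by move=> ? ? [].
by apply/negP => /mapP[].
Qed.

Let past_setI n : setI_closed (past n).
Proof.
move=> _ _ [F mF ->] [G mG ->]; exists (fun i => F i `&` G i).
  by move=> i; exact: input_setI.
by rewrite big_split.
Qed.

Let past_measurable n : past n `<=` measurable.
Proof.
by move=> _ [F mF ->]; apply: bigsetI_measurable => i _; exact: input_measurable (mF i).
Qed.

Let past_input n i A : i \in inputs n -> input_sigma_algebra x0 w i A -> past n A.
Proof.
move=> ni mA; exists (fun j => if j == i then A else setT).
  by move=> j; case: eqP => [->//|_]; exact: input_setT.
by rewrite (bigD1_seq i)//=; [rewrite eqxx big1 ?setIT// => j /negPf ->|exact: inputs_uniq].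
Qed.

Let past_indep n A B : past n A -> measurable B ->
  P (A `&` w n @^-1` B) = (P A * P (w n @^-1` B))%E.
Proof.
move=> [F mF ->] mB; have [_ _ indep] := P_product.
(* Mutual independence is used for [G] on the inputs enlarged by [Some n] and for [F] on the inputs
   alone; comparing the two products isolates the factor of [w n]. *)
pose G i := if i == Some n then w n @^-1` B else F i.
have mG i : input_sigma_algebra x0 w i (G i).
  by rewrite /G; case: eqP => [->|//]; exists B; rewrite ?setTI.
have Gn : G (Some n) = w n @^-1` B by rewrite /G eqxx.
have nn : Some n \notin inputs n.
  rewrite inE negb_or/=; apply/negP => /mapP[m].
  by rewrite mem_iota => /andP[_ +] [nm]; rewrite -nm ltnn.
have GF i : i \in inputs n -> G i = F i.
  by move=> ni; rewrite /G; case: eqP ni nn => // -> ->.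
have := indep (Some n :: inputs n) G; rewrite cons_uniq nn inputs_uniq => /(_ isT).
rewrite big_cons [in RHS]big_cons => h.
have {h} := h (fun i _ => mG i).
rewrite Gn (eq_big_seq F GF) => h.
rewrite setIC h muleC; congr (_ * _)%E.
rewrite [RHS](indep (inputs n) F)//.
by apply: eq_big_seq => i /GF ->.
Qed.

(** The noise [w m] first acts at time [m.+1], so the position at time [m] uses only the inputs
    before it. *)
Lemma measurable_orbit_at m n : (m <= n)%N ->
  measurable_fun setT (Y m : g_sigma_algebraType (past n) -> circle R).
Proof.
elim: m => [|m IH] mn.
  move=> _ B mB; apply: sub_sigma_algebra; apply: (@past_input n None).
    by rewrite inE eqxx.
  by exists B.
have mw : measurable_fun setT (w m : g_sigma_algebraType (past n) -> R).
  move=> _ B mB; apply: sub_sigma_algebra; apply: (@past_input n (Some m)); last by exists B.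
  by rewrite inE/=; apply/mapP; exists m => //; rewrite mem_iota.
exact: (measurableT_comp (circle_add_measurable alpha)
  (measurable_fun_pair (IH (ltnW mn)) mw)).
Qed.

(** The noise [w n] is independent of the past that determines [A] and [Y n], so it can be averaged
    with that past frozen, which produces [Q]. *)
Lemma markov_step n A g : <<s past n >> A -> bounded_ge0 g ->
  (\int[P]_s (\1_A s * g (Y n.+1 s))%:E = \int[P]_s (\1_A s * Q g (Y n s))%:E)%E.
Proof.
move=> pA bg; have [_ w_law _] := P_product.
pose f (p : g_sigma_algebraType (past n) * measurableTypeR R) :=
  (\1_A p.1 * g (perturbed_rotation alpha p.2 (Y n p.1)))%:E.
have mf : measurable_fun setT f.
  apply/measurable_EFinP; apply: measurable_funM.
    by apply: (measurableT_comp _ measurable_fst); exact: measurable_indic.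
  exact: (measurableT_comp bg.1 (measurableT_comp (circle_add_measurable alpha)
    (measurable_fun_pair (measurableT_comp (measurable_orbit_at (leqnn n)) measurable_fst)
      measurable_snd))).
have f0 p : (0 <= f p)%E.
  by rewrite lee_fin mulr_ge0//; exact: bounded_ge0_ge0.
have mwn : measurable_fun setT (w n : T -> measurableTypeR R).
  by have := @measurable_funPT _ _ _ _ (w n); move=> mw mT B mB; exact: mw.
pose wn : {mfun T >-> measurableTypeR R} :=
  HB.pack (w n : T -> measurableTypeR R) (isMeasurableFun.Build _ _ _ _ _ mwn).
have := @integral_indep _ _ _ P _ _ _ wn (@past_setI n) (@past_measurable n)
  (@past_indep n) f mf f0.
rewrite /f/= => ->; apply: eq_integral => s _.
transitivity (\int[nu]_r (\1_A s * g (perturbed_rotation alpha r (Y n s)))%:E)%E.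
  by apply: eq_measure_integral => B mB _; exact: w_law.
under eq_integral do rewrite EFinM.
rewrite ge0_integralZl//=; last 2 first.
- by apply/measurable_EFinP; exact: (bounded_ge0_noise alpha (Y n s) bg).1.
- by move=> r _; rewrite lee_fin; exact: bounded_ge0_ge0.
by rewrite EFinM EFin_transition.
Qed.

(** Membership in every past lets the indicator of [A] be carried through all the Markov steps down
    to time 0. *)
Definition initial_event (A : set T) := forall n, <<s past n >> A.

Lemma initial_event_x0 B : measurable B -> initial_event (x0 @^-1` B).
Proof.
move=> mB n; apply: sub_sigma_algebra; apply: (@past_input n None).
  by rewrite inE eqxx.
by exists B; rewrite ?setTI.
Qed.

Lemma markov_iter n A g : initial_event A -> bounded_ge0 g ->
  (\int[P]_s (\1_A s * g (Y n s))%:E = \int[P]_s (\1_A s * iter n Q g (x0 s))%:E)%E.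
Proof.
move=> iA; elim: n g => //= n IH g bg.
rewrite markov_step// IH; last exact: transition_bounded_ge0.
by rewrite -iterSr.
Qed.

(** The function obtained from 1 by applying [l] times the killed operator [g => \1_V * Q g]: the
    probability, from a given start, of being in [V] at times [0, ..., l - 1]. *)
Fixpoint stay (V : set (circle R)) l : circle R -> R :=
  if l is l'.+1 then fun y => \1_V y * Q (stay V l') y else fun=> 1.

Lemma stay_bounded V l : measurable V ->
  bounded_ge0 (stay V l) /\ forall y, stay V l y <= 1.
Proof.
move=> mV; elim: l => [|l [bl l1]] /=.
  by split => //; exact: bounded_ge0_cst.
have Q1 y : \1_V y * Q (stay V l) y <= 1.
  apply: mulr_ile1 => //; rewrite ?indicE ?lern1 ?leq_b1//.
    by apply: bounded_ge0_ge0; exact: transition_bounded_ge0.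
  rewrite -[leRHS](transition_cst alpha eps0 1 y).
  by apply: transition_le => //; exact: bounded_ge0_cst.
split => //; split.
  apply: measurable_funM; first exact: measurable_indic.
  exact: (transition_bounded_ge0 alpha eps0 bl).1.
exists 1 => y; rewrite Q1 andbT mulr_ge0//.
by apply: bounded_ge0_ge0; exact: transition_bounded_ge0.
Qed.

(** Induction on the length, with [t] and [A] varying: the condition at time [t] is absorbed into
    [A], the rest of the block starts at [t.+1], and one Markov step returns to time [t]. *)
Lemma stay_block_prob V l t A : measurable V -> (forall n, (t <= n)%N -> <<s past n >> A) ->
  P (A `&` [set s | forall j, (t <= j < t + l)%N -> V (Y j s)]) =
  (\int[P]_s (\1_A s * stay V l (Y t s))%:E)%E.
Proof.
move=> mV; elim: l t A => [|l IH] t A pA.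
  rewrite (_ : A `&` _ = A).
    under eq_integral do rewrite mulr1.
    rewrite integral_indic ?setIT//.
    exact: (generated_measurable (@past_measurable t)) (pA t (leqnn t)).
  rewrite -[RHS]setIT; congr (_ `&` _); apply/seteqP; split => // s _ j.
  by rewrite addn0 => /andP[tj /(leq_ltn_trans tj)]; rewrite ltnn.
rewrite [A `&` _](_ : _ = (A `&` Y t @^-1` V) `&`
    [set s | forall j, (t.+1 <= j < t.+1 + l)%N -> V (Y j s)]); last first.
  apply/seteqP; split => s /=.
    move=> [As h]; split; first split => //.
      by apply: h; rewrite leqnn/= addnS ltnS leq_addr.
    by move=> j /andP[tj jl]; apply: h; rewrite (ltnW tj)/= -addSnnS.
  move=> [[As Vt] h]; split => // j /andP[tj jl].
  have [->//|jt] := eqVneq j t.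
  by apply: h; rewrite ltn_neqAle eq_sym jt tj/= addSnnS.
have pA' n : (t <= n)%N -> <<s past n >> (A `&` Y t @^-1` V).
  move=> tn.
  have mY : <<s past n >> (Y t @^-1` V).
    by have := measurable_orbit_at tn measurableT mV; rewrite setTI.
  exact: (@measurableI _ (g_sigma_algebraType (past n)) _ _ (pA n tn) mY).
rewrite IH; last by move=> n tn; apply: pA'; exact: ltnW.
rewrite markov_step//; last 2 first.
- exact: pA'.
- exact: (stay_bounded l mV).1.
apply: eq_integral => s _; congr EFin.
by rewrite /= mulrA; congr (_ * _); rewrite !indicE in_setI -mulnb natrM.
Qed.

Hypothesis mu_stationary : is_stationary alpha eps0 mu.

Lemma initial_integral U g : measurable U -> bounded_ge0 g ->
  (\int[P]_s (\1_(x0 @^-1` U) s * g (x0 s))%:E = (\int[mu]_y (\1_U y * g y))%:E)%E.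
Proof.
move=> mU bg; have [x0_law _ _] := P_product.
have bUg := bounded_ge0_indicM mU bg.
rewrite bounded_ge0_EFin_Rintegral//.
transitivity (\int[distribution P x0]_y (\1_U y * g y)%:E)%E; last first.
  by apply: eq_measure_integral => B mB _; exact: x0_law.
rewrite ge0_integral_pushforward//=.
- by apply/measurable_EFinP; exact: bUg.1.
- by move=> y _; rewrite lee_fin; exact: bounded_ge0_ge0 bUg.
Qed.

Lemma hit_stay_prob U V t l : measurable U -> measurable V ->
  P [set s | U (x0 s) /\ forall j, (t <= j < t + l)%N -> V (Y j s)] =
  (\int[mu]_y (\1_U y * iter t Q (stay V l) y))%:E.
Proof.
move=> mU mV; have [bl _] := stay_bounded l mV.
rewrite -initial_integral//; last exact: iter_transition_bounded_ge0.
rewrite -markov_iter//; last exact: initial_event_x0.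
rewrite -stay_block_prob// => n _.
exact: initial_event_x0.
Qed.

Lemma stay_prob V t l : measurable V ->
  P [set s | forall j, (t <= j < t + l)%N -> V (Y j s)] = (\int[mu]_y stay V l y)%:E.
Proof.
move=> mV; have [bl _] := stay_bounded l mV.
have := hit_stay_prob t l (@measurableT _ (circle R)) mV.
rewrite (_ : [set s | _] = [set s | forall j, (t <= j < t + l)%N -> V (Y j s)]) => [->|].
  rewrite -(stationary_iter_transition mu_stationary t bl); congr EFin.
  by apply: eq_Rintegral => y _; rewrite indicT mul1r.
by apply/seteqP; split => s //= [].
Qed.

End MarkovProperty.

(** * Hitting probabilities *)

Section HittingEstimates.
Variables (R : realType) (alpha eps : R) (eps0 : 0 < eps).
Local Notation Q := (transition alpha eps0).
Local Notation stay := (stay alpha eps0).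
Variables (mu : probability (circle R) R) (mu_stationary : is_stationary alpha eps0 mu).
Variables (rho : nat -> R) (C : R).
Hypothesis rho_le : forall t t', (t <= t')%N -> rho t' <= rho t.
Hypothesis rho_mixing : forall g, bounded_ge0 g -> (forall x, g x <= 1) ->
  forall t x y, iter t Q g x - iter t Q g y <= rho t.
Hypothesis C0 : 0 < C.
Hypothesis C_mean : forall g, bounded_ge0 g -> forall x, Q g x <= C * \int[mu]_y g y.
Variables (U : set (circle R)) (mU : measurable U).
Implicit Types (g h : circle R -> R).
Let V := ~` U.
Let mV : measurable V. Proof. exact: measurableC. Qed.
Let p : R := \int[mu]_x \1_U x.
Let a l : R := \int[mu]_x stay V l x.

Let bounded_stay l : bounded_ge0 (stay V l).
Proof. by have [] := stay_bounded alpha eps0 l mV. Qed.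

Let stay_le1 l x : stay V l x <= 1.
Proof. by have [_] := stay_bounded alpha eps0 l mV. Qed.

Let mean_indic_cst c : \int[mu]_x (\1_U x * c) = c * p.
Proof.
under eq_Rintegral do rewrite mulrC.
by rewrite RintegralZl//; exact: bounded_ge0_integrable (bounded_ge0_indic R mU).
Qed.

Let p_ge0 : 0 <= p.
Proof. by apply: Rintegral_ge0 => x _; exact: bounded_ge0_ge0 (bounded_ge0_indic R mU). Qed.

Let p_le1 : p <= 1.
Proof.
rewrite -[leRHS](Rintegral_probability_cst mu); apply: bounded_ge0_Rintegral_le.
- exact: bounded_ge0_indic.
- exact: bounded_ge0_cst.
- by move=> x; rewrite indicE lern1 leq_b1.
Qed.

Lemma mean_indic_le g b : bounded_ge0 g -> (forall x, g x <= b) ->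
  \int[mu]_x (\1_U x * g x) <= b * p.
Proof.
move=> bg gb; have b0 : 0 <= b by rewrite (le_trans _ (gb 0))// bounded_ge0_ge0.
rewrite -mean_indic_cst; apply: bounded_ge0_Rintegral_le.
- exact: bounded_ge0_indicM.
- by apply: bounded_ge0_indicM => //; exact: bounded_ge0_cst.
- by move=> x; rewrite ler_wpM2l.
Qed.

Lemma mean_indic_ge g b : bounded_ge0 g -> (forall x, b <= g x) ->
  b * p <= \int[mu]_x (\1_U x * g x).
Proof.
(* The bound may be negative, as [a l - rho t] can be; the claim is then immediate from the sign of
   the integral. *)
move=> bg gb; have [b0|/ltW b0] := leP 0 b; last first.
  apply: (@le_trans _ _ 0); first by rewrite mulr_le0_ge0.
  by apply: Rintegral_ge0 => x _; exact: bounded_ge0_ge0 (bounded_ge0_indicM mU bg).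
rewrite -mean_indic_cst; apply: bounded_ge0_Rintegral_le.
- by apply: bounded_ge0_indicM => //; exact: bounded_ge0_cst.
- exact: bounded_ge0_indicM.
- by move=> x; rewrite ler_wpM2l.
Qed.

Let rho_ge0 t : 0 <= rho t.
Proof.
have b1 : bounded_ge0 (fun=> 1 : R) (T := circle R) by exact: bounded_ge0_cst.
by have := rho_mixing b1 (fun=> lexx _) t 0 0; rewrite subrr.
Qed.

Lemma dist_iter_stay_le t l x : `|iter t Q (stay V l) x - a l| <= rho t.
Proof.
rewrite /a -(stationary_iter_transition mu_stationary t)//.
apply: dist_mean_le_oscillation => [|y z].
  exact: iter_transition_bounded_ge0.
exact: rho_mixing.
Qed.

(** The estimate for D2. The mixing bound is uniform in the starting point, so integrating it over
    [U] gives the factor [p]. *)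
Lemma hit_stay_decorrelation t l :
  `|\int[mu]_x (\1_U x * iter t Q (stay V l) x) - p * a l| <= p * rho t.
Proof.
have bQ := iter_transition_bounded_ge0 alpha eps0 t (bounded_stay l).
have h x := dist_iter_stay_le t l x.
have lb : (a l - rho t) * p <= \int[mu]_x (\1_U x * iter t Q (stay V l) x).
  by apply: mean_indic_ge => // x; have := h x; rewrite ler_norml => /andP[]; lra.
have ub : \int[mu]_x (\1_U x * iter t Q (stay V l) x) <= (a l + rho t) * p.
  by apply: mean_indic_le => // x; have := h x; rewrite ler_norml => /andP[]; lra.
rewrite ler_norml; apply/andP; split; lra.
Qed.

(** The estimate for D'. One application of [Q] is bounded by [C] times a mean, and stationarity
    identifies that mean with [p]. *)
Lemma return_prob_le j : (0 < j)%N ->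
  \int[mu]_x (\1_U x * iter j Q \1_U x) <= C * p * p.
Proof.
case: j => // j _; apply: mean_indic_le => [|x].
  by apply: iter_transition_bounded_ge0; exact: bounded_ge0_indic.
rewrite /= (le_trans (C_mean _ _))//.
  by apply: iter_transition_bounded_ge0; exact: bounded_ge0_indic.
by rewrite (stationary_iter_transition mu_stationary)//; exact: bounded_ge0_indic.
Qed.

Let transitionD g h x : bounded_ge0 g -> bounded_ge0 h ->
  Q (fun y => g y + h y) x = Q g x + Q h x.
Proof.
move=> bg bh; rewrite /transition RintegralD//;
  by [apply: bounded_ge0_integrable; exact: bounded_ge0_noise].
Qed.

Let boundedD g h : bounded_ge0 g -> bounded_ge0 h ->
  bounded_ge0 (fun y : circle R => g y + h y).
Proof.
move=> bg bh; split; first by apply: measurable_funD; [exact: bg.1|exact: bh.1].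
have [_ [K gK]] := bg; have [_ [L hL]] := bh.
by exists (K + L) => y; have /andP[? ?] := gK y; have /andP[? ?] := hL y; lra.
Qed.

Let indicVU x : \1_V x = 1 - \1_U x :> R.
Proof. by rewrite /V !indicE in_setC; case: (x \in U) => /=; lra. Qed.

Let stay_le_iter k l x : stay V (k + l) x <= iter k Q (stay V l) x.
Proof.
elim: k x => // k IH x; rewrite addSn /=.
have Qle : Q (stay V (k + l)) x <= Q (iter k Q (stay V l)) x.
  by apply: transition_le => //; exact: iter_transition_bounded_ge0.
apply: le_trans Qle; rewrite -[leRHS]mul1r ler_wpM2r//.
  by apply: bounded_ge0_ge0; exact: transition_bounded_ge0.
Qed.

(** The two terms differ by avoidance at times [1, ..., k], and from any start each of these times
    meets [U] with probability at most [C * p]. *)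
Let transition_stay_ge k l x :
  iter k.+1 Q (stay V l) x - k%:R * (C * p) <= Q (stay V (k + l)) x.
Proof.
elim: k x => [|k IH] x; first by rewrite mul0r subr0.
have kCp : 0 <= k%:R * (C * p) by rewrite mulr_ge0// mulr_ge0// ltW.
have bk : bounded_ge0 (fun y : circle R => \1_U y + k%:R * (C * p)).
  by apply: boundedD; [exact: bounded_ge0_indic|exact: bounded_ge0_cst].
have : Q (iter k.+1 Q (stay V l)) x <=
    Q (fun y => stay V (k.+1 + l) y + (\1_U y + k%:R * (C * p))) x.
  apply: transition_le => [| |y].
  - exact: iter_transition_bounded_ge0.
  - exact: boundedD.
  (* Outside [U] the inequality is the induction hypothesis; on [U] the stay probability vanishes
     and the added [\1_U] dominates the iterate, which is at most 1. *)
  have -> : stay V (k.+1 + l) y = \1_V y * Q (stay V (k + l)) y by [].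
  rewrite indicVU indicE; have := IH y.
  case: (y \in U); rewrite /= ?subrr ?mul0r ?subr0 ?mul1r; last lra.
  have h1 : Q (iter k Q (stay V l)) y <= 1.
    rewrite -[leRHS](transition_cst alpha eps0 1 y); apply: transition_le.
    - exact: iter_transition_bounded_ge0.
    - exact: bounded_ge0_cst.
    move=> z; elim: k z {IH kCp bk} => //= k IHk z.
    rewrite -[leRHS](transition_cst alpha eps0 1 z); apply: transition_le => //.
    - exact: iter_transition_bounded_ge0.
    - exact: bounded_ge0_cst.
  lra.
rewrite transitionD// transitionD//; last exact: bounded_ge0_cst; last exact: bounded_ge0_indic.
rewrite transition_cst.
have := C_mean (bounded_ge0_indic R mU) x; rewrite -/p.
by rewrite -(natr1 k) [iter k.+2 _ _]/=; lra.
Qed.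

(** By stationarity [a l] is also the mean of [Q (stay V l)]; the integrands then differ by the
    factor [1 - \1_V = \1_U]. *)
Lemma stay_mean_succ l : a l - a l.+1 = \int[mu]_x (\1_U x * Q (stay V l) x).
Proof.
have bQ := transition_bounded_ge0 alpha eps0 (bounded_stay l).
rewrite /a -(stationary_transition mu_stationary)// -RintegralB//.
- apply: eq_Rintegral => x _; rewrite /= indicVU; lra.
- exact: bounded_ge0_integrable.
- exact: bounded_ge0_integrable (bounded_stay l.+1).
Qed.

Let transition_stay_le1 l x : Q (stay V l) x <= 1.
Proof.
rewrite -[leRHS](transition_cst alpha eps0 1 x); apply: transition_le => //.
exact: bounded_ge0_cst.
Qed.

Lemma stay_mean_shift k l : a l - k%:R * p <= a (k + l) <= a l.
Proof.
elim: k => [|k /andP[h1 h2]]; first by rewrite mul0r subr0 lexx.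
have bQ := transition_bounded_ge0 alpha eps0 (bounded_stay (k + l)).
have ub := mean_indic_le bQ (transition_stay_le1 (k + l)).
have lb := mean_indic_ge bQ (fun x => bounded_ge0_ge0 x bQ).
by move: ub lb; rewrite -stay_mean_succ -natr1 addSn; lra.
Qed.

Lemma dist_transition_stay_le t l x :
  `|Q (stay V l) x - a l| <= rho t + t%:R * ((C + 1) * p).
Proof.
(* The first [k] avoidance conditions are dropped, at cost [k * C * p] in the transition and [k * p]
   in the mean. If [l < t], nothing remains to be avoided and the oscillation is zero. *)
pose k := minn t l.
have kt : k%:R <= t%:R :> R by rewrite ler_nat geq_minl.
have osc : `|iter k.+1 Q (stay V (l - k)) x - a (l - k)| <= rho t.
  have [tl|lt] := leqP t l.
    apply: le_trans (dist_iter_stay_le _ _ _) _.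
    by apply: rho_le; rewrite /k (minn_idPl tl).
  rewrite /k (minn_idPr (ltnW lt)) subnn /a.
  rewrite (_ : iter l.+1 Q (stay V 0) x = 1).
    by rewrite (Rintegral_probability_cst mu 1) subrr normr0.
  elim: l.+1 x => //= m IH x.
  rewrite -[RHS](transition_cst alpha eps0 1 x); congr (Q _ x).
  by apply/funext => y; exact: IH.
have := stay_mean_shift k (l - k); have := transition_stay_ge k (l - k) x.
have : Q (stay V (k + (l - k))) x <= iter k.+1 Q (stay V (l - k)) x.
  by apply: transition_le => //; exact: iter_transition_bounded_ge0.
rewrite subnKC ?geq_minr// => h1 h2 /andP[h3 h4].
have kC : k%:R * ((C + 1) * p) <= t%:R * ((C + 1) * p).
  by rewrite ler_wpM2r// mulr_ge0// addr_ge0// ltW.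
have kp : 0 <= k%:R * p by rewrite mulr_ge0.
have kCp : 0 <= k%:R * (C * p) by rewrite mulr_ge0// mulr_ge0// ltW.
by move: osc; rewrite !ler_norml => /andP[? ?]; apply/andP; split; lra.
Qed.

(** The sequence satisfies [a (n + 1) = (1 - p) * a n] up to [p * eta]. Since [0 <= 1 - p <= 1],
    earlier errors are not amplified and they add up linearly. *)
Lemma stay_mean_approx t n :
  `|a n - (1 - p) ^+ n| <= n%:R * (p * (rho t + t%:R * ((C + 1) * p))).
Proof.
set eta := rho t + _.
elim: n => [|n IH].
  by rewrite /a /= (Rintegral_probability_cst mu 1) expr0 subrr normr0 mul0r.
have bQ := transition_bounded_ge0 alpha eps0 (bounded_stay n).
have h x : `|Q (stay V n) x - a n| <= eta by exact: dist_transition_stay_le.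
have lb : (a n - eta) * p <= a n - a n.+1.
  rewrite stay_mean_succ; apply: mean_indic_ge => // x.
  by have := h x; rewrite ler_norml => /andP[]; lra.
have ub : a n - a n.+1 <= (a n + eta) * p.
  rewrite stay_mean_succ; apply: mean_indic_le => // x.
  by have := h x; rewrite ler_norml => /andP[]; lra.
have q0 : 0 <= 1 - p by have := p_le1; lra.
have IH' : (1 - p) * `|a n - (1 - p) ^+ n| <= n%:R * (p * eta).
  apply: le_trans IH; rewrite -[leRHS]mul1r ler_wpM2r//; have := p_ge0; lra.
rewrite -[X in X * `|_|]ger0_norm// -normrM in IH'.
rewrite -natr1 exprS; move: IH'; rewrite !ler_norml => /andP[? ?].
by apply/andP; split; lra.
Qed.

End HittingEstimates.

(** * The Poisson limit *)

Section Limits.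
Variable R : realType.

Lemma cvg_invn : (n%:R^-1 : R) @[n --> \oo] --> (0 : R).
Proof. by rewrite -cvg_shiftS; exact: cvg_harmonic. Qed.

Lemma cvg_EFin_seq (s : nat -> R) (l : R) :
  (s n)%:E @[n --> \oo] --> l%:E <-> s n @[n --> \oo] --> l.
Proof.
split=> [/fine_cvgP[]//|sl]; apply: cvg_EFin => //.
by apply: nearW.
Qed.

(** One slowly growing sequence serves as both [t_] and [k] in D2 and D'. Base 8 gives
    [gap n ^ 3 <= n], because [8 ^ g = (2 ^ g) ^ 3] and [g < 2 ^ g]; hence [gap n ^ 2] is [o(n)]. *)
Definition gap (n : nat) : nat := trunc_log 8 n.

Lemma cvg_gap : gap n @[n --> \oo] --> \oo.
Proof.
move=> A [m _ Am]; exists (8 ^ m)%N => // n /= mn.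
by apply: Am => /=; exact: trunc_log_max.
Qed.

Lemma gap_cube_le n : (0 < n)%N -> (gap n * gap n * gap n <= n)%N.
Proof.
move=> n0; apply: (leq_trans _ (trunc_logP (isT : 1 < 8)%N n0)).
rewrite -/(gap n) -[8%N]/(2 * 2 * 2)%N !expnMn.
by rewrite !leq_mul// ltnW// ltn_expl.
Qed.

Lemma gap_sqr_little_o : little_o_n R (fun n => gap n * gap n)%N.
Proof.
apply: (@squeeze_cvgr _ _ _ _ (fun=> 0) (fun n => (gap n)%:R^-1)).
- apply: nearW => n; rewrite divr_ge0//=.
  have [->|n0] := posnP n; first by rewrite /gap trunc_log0 mul0n mul0r invr0.
  have [->|g0] := posnP (gap n); first by rewrite mul0r invr0.
  rewrite ler_pdivrMr ?ltr0n// ler_pdivlMl ?ltr0n// -natrM ler_nat mulnA.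
  exact: gap_cube_le.
- exact: cvg_cst.
- by apply: (@cvg_comp _ _ _ gap (fun n => n%:R^-1) _ \oo); [exact: cvg_gap|exact: cvg_invn].
Qed.

Lemma gap_little_o : little_o_n R gap.
Proof.
apply: (@squeeze_cvgr _ _ _ _ (fun=> 0) (fun n => (gap n * gap n)%:R / n%:R)).
- apply: nearW => n; rewrite divr_ge0//= ler_wpM2r// ler_nat.
  by case: (gap n) => // m; exact: leq_pmulr.
- exact: cvg_cst.
- exact: gap_sqr_little_o.
Qed.

(** Squeeze by [n]-th powers of [exp (- p / (1 - p)) <= 1 - p <= exp (- p)], valid once
    [p n < 1]. *)
Lemma cvg_expr_one_sub (p : nat -> R) (tau : R) :
  (forall n, 0 <= p n <= 1) -> n%:R * p n @[n --> \oo] --> tau ->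
  (1 - p n) ^+ n @[n --> \oo] --> expR (- tau).
Proof.
move=> p01 np.
have p0 : p n @[n --> \oo] --> (0 : R).
  rewrite -[X in _ --> X](mul0r tau).
  apply: (cvg_trans _ (cvgM cvg_invn np)); apply: near_eq_cvg.
  exists 1%N => // n /= n0; rewrite mulKf// pnatr_eq0 -lt0n//.
have e1 : expR (- (n%:R * p n)) @[n --> \oo] --> expR (- tau).
  apply: (@cvg_comp _ _ _ (fun n => - (n%:R * p n)) expR _ (nbhs (- tau)));
    last exact: continuous_expR.
  exact: cvgN.
have e2 : expR (- (n%:R * p n / (1 - p n))) @[n --> \oo] --> expR (- tau).
  apply: (@cvg_comp _ _ _ (fun n => - (n%:R * p n / (1 - p n))) expR _ (nbhs (- tau)));
    last exact: continuous_expR.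
  apply: cvgN; rewrite -[X in _ --> X]divr1; apply: cvgM => //.
  apply: cvgV; first exact: oner_neq0.
  rewrite -[X in _ --> X](subr0 1).
  by apply: cvgB => //; exact: cvg_cst.
apply: (squeeze_cvgr _ e2 e1).
have : \forall n \near \oo, p n < 1 by apply: cvgr_lt p0 _ ltr01.
apply: filterS => n pn1; have /andP[pn0 _] := p01 n.
have q0 : 0 < 1 - p n by rewrite subr_gt0.
have h1 : 1 - p n <= expR (- p n) by exact: expR_ge1Dx.
have h2 : expR (- (p n / (1 - p n))) <= 1 - p n.
  rewrite expRN -[leRHS]invrK lef_pV2 ?posrE ?invr_gt0 ?expR_gt0//.
  apply: le_trans (expR_ge1Dx _); rewrite le_eqVlt; apply/orP; left; apply/eqP.
  by field; rewrite gt_eqF.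
apply/andP; split; rewrite -?mulrA -mulrN expRM_natl;
  by rewrite lerXn2r// nnegrE ?expR_ge0// ltW.
Qed.

Lemma cvg_of_power_approx (rho a p : nat -> R) (C tau : R) :
  0 <= C -> rho t @[t --> \oo] --> (0 : R) ->
  (forall n, 0 <= p n <= 1) -> n%:R * p n @[n --> \oo] --> tau ->
  (forall t n, `|a n - (1 - p n) ^+ n| <= n%:R * (p n * (rho t + t%:R * (C * p n)))) ->
  a n @[n --> \oo] --> expR (- tau).
Proof.
move=> C0 rho0 p01 np approx.
(* This is the error at [t = gap n], arranged so that [n * p n] stays bounded while [rho (gap n)]
   and [gap n / n] tend to 0. *)
pose b n := n%:R * p n * (rho (gap n) + C * (n%:R * p n) * ((gap n)%:R / n%:R)).
have b0 : b n @[n --> \oo] --> (0 : R).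
  rewrite -(mulr0 tau) -[X in _ * X](addr0 0) -[X in _ * (_ + X)](mulr0 (C * tau)).
  apply: cvgM => //; apply: cvgD.
    by apply: (@cvg_comp _ _ _ gap rho _ \oo); [exact: cvg_gap|exact: rho0].
  apply: cvgM; last exact: gap_little_o.
  by apply: cvgM => //; exact: cvg_cst.
have d0 : a n - (1 - p n) ^+ n @[n --> \oo] --> (0 : R).
  apply/norm_cvg0P; apply: (@squeeze_cvgr _ _ _ _ (fun=> 0) b) => //; last exact: cvg_cst.
  apply: nearW => n; rewrite normr_ge0/=.
  apply: le_trans (approx (gap n) n) _.
  have [->|n0] := posnP n; first by rewrite /b !mul0r.
  rewrite le_eqVlt; apply/orP; left; apply/eqP; rewrite /b.
  by field; rewrite pnatr_eq0 -lt0n.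
rewrite -[X in _ --> X]add0r.
rewrite (_ : a = fun n => a n - (1 - p n) ^+ n + (1 - p n) ^+ n); last first.
  by apply/funext => n; rewrite subrK.
by apply: cvgD => //; exact: cvg_expr_one_sub.
Qed.

(** An extreme value law needs levels for every rate, but only those for [tau] are given. With [m]
    the integer part of [n * tau / sigma], [n * p m = (n / m) * (m * p m)] tends to
    [(sigma / tau) * tau]. *)
Lemma cvg_subsequence_rate (p : nat -> R) (tau sigma : R) : 0 < tau -> 0 < sigma ->
  n%:R * p n @[n --> \oo] --> tau ->
  n%:R * p (Num.truncn (n%:R * (tau / sigma))) @[n --> \oo] --> sigma.
Proof.
move=> tau0 sigma0 np.
pose c := tau / sigma; have c0 : 0 < c by rewrite divr_gt0.
pose m n := Num.truncn (n%:R * c).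
have mn n : n%:R * c - 1 <= (m n)%:R <= n%:R * c.
  have := @truncn_itv R (n%:R * c); rewrite mulr_ge0//; last exact: ltW.
  by move=> /(_ isT)/andP[h1]; rewrite -natr1 -/(m n); lra.
have moo : m n @[n --> \oo] --> \oo.
  move=> A [k _ Ak]; exists (Num.truncn (k.+1%:R / c)).+1 => // n /= kn.
  apply: Ak => /=; rewrite -(ler_nat R) -(lerD2r 1) natr1.
  have /andP[h _] := mn n; have := truncnS_gt (k.+1%:R / c).
  rewrite ltr_pdivrMr// => h2.
  have : (Num.truncn (k.+1%:R / c)).+1%:R * c <= n%:R * c.
    by rewrite ler_wpM2r ?(ltW c0)// ler_nat.
  by lra.
have r1 : (m n)%:R / n%:R @[n --> \oo] --> c.
  apply: (@squeeze_cvgr _ _ _ _ (fun n => c - n%:R^-1) (fun=> c)); last 2 first.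
  - rewrite -[X in _ --> X]subr0; apply: cvgB; [exact: cvg_cst|exact: cvg_invn].
  - exact: cvg_cst.
  exists 1%N => // n /= n0; have /andP[h1 h2] := mn n.
  have n0' : (0 : R) < n%:R by rewrite ltr0n.
  rewrite ler_pdivrMr// ler_pdivlMr// mulrBl mulVf ?gt_eqF//; apply/andP; split; lra.
have r2 : ((m n)%:R / n%:R)^-1 * ((m n)%:R * p (m n)) @[n --> \oo] --> sigma.
  rewrite (_ : sigma = c^-1 * tau); last by rewrite /c; field; rewrite !gt_eqF.
  apply: cvgM; last exact: (@cvg_comp _ _ _ m (fun n => n%:R * p n) _ \oo).
  by apply: cvgV => //; rewrite gt_eqF.
apply: cvg_trans r2; apply: near_eq_cvg.
have : \forall n \near \oo, (0 < m n)%N by apply: (moo [set k | (0 < k)%N]); exists 1%N.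
apply: filterS2 (nbhs_infty_gt 0) => n n0 m0.
by field; rewrite !pnatr_eq0 -!lt0n n0 m0.
Qed.

End Limits.

(** * The exponential distribution function *)

Section ExponentialCdf.
Variable R : realType.

Definition expo_cdf (y : R) : R := 1 - expR (- Num.max 0 y).

Let expo_cdf_nondecreasing : nondecreasing expo_cdf.
Proof.
move=> x y xy; rewrite /expo_cdf lerD2l lerN2 ler_expR lerN2.
by rewrite ge_max !le_max lexx xy orbT.
Qed.

Let expo_cdf_right_continuous : right_continuous expo_cdf.
Proof.
move=> x; apply: cvg_at_right_filter.
apply: cvgB; first exact: cvg_cst.
apply: (@cvg_comp _ _ _ (fun y => - Num.max 0 y) expR _ (nbhs (- Num.max 0 x)));
  last exact: continuous_expR.
apply: cvgN; apply: continuous_max; [exact: cvg_cst|exact: cvg_id].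
Qed.

Let expo_cdfNy : expo_cdf @ -oo --> (0 : R).
Proof.
apply: cvg_near_cst; exists 0; split => // y y0.
by rewrite /expo_cdf (max_idPl (ltW y0)) oppr0 expR0 subrr.
Qed.

Let expo_cdfy : expo_cdf @ +oo --> (1 : R).
Proof.
rewrite -[X in _ --> X](subr0 1); apply: cvgB; first exact: cvg_cst.
apply: cvg_trans (@cvgr_expR R); apply: near_eq_cvg.
exists 0; split => // y y0.
by rewrite (max_idPr (ltW y0)).
Qed.

HB.instance Definition _ := isCumulative.Build R _ R expo_cdf
  expo_cdf_nondecreasing expo_cdf_right_continuous.
HB.instance Definition _ := isCumulativeBounded.Build R 0 1 expo_cdf
  expo_cdfNy expo_cdfy.

Lemma expo_cdf_survival y : 0 <= y -> 1 - expo_cdf y = expR (- y).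
Proof. by move=> y0; rewrite /expo_cdf subKr (max_idPr y0). Qed.

Lemma expo_cdf0 : expo_cdf 0 = 0.
Proof. by rewrite /expo_cdf maxxx oppr0 expR0 subrr. Qed.

Lemma expo_cdf_non_degenerate : ~ degenerate expo_cdf.
Proof.
(* The value at 1 lies strictly between 0 and 1, the only values of a degenerate law. *)
move=> [a /(_ 1)]; rewrite /expo_cdf (max_idPr ler01).
have := expR_gt0 (- 1 : R); have : expR (- 1) < 1 :> R by rewrite expR_lt1; lra.
by case: (a <= 1) => /=; lra.
Qed.

Definition expo_cdf_cumulative : cumulativeBounded (0 : R) (1 : R) := expo_cdf.

End ExponentialCdf.

(** * Exceedance probabilities as integrals over the circle *)

Lemma block_max_leP d (T : measurableType d) (R : realType) (X : nat -> T -> \bar R) t l s c :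
  (block_max X t l s <= c)%E <-> forall j, (t <= j < t + l)%N -> (X j s <= c)%E.
Proof.
rewrite /block_max; elim: l => [|l IH].
  rewrite addn0 big_geq//; split=> [_ j /andP[tj]|]; last by rewrite leNye.
  by rewrite ltnNge tj.
rewrite addnS big_nat_recr ?leq_addr//= ge_max; split.
  move=> /andP[/IH h1 h2] j /andP[tj]; rewrite ltnS leq_eqVlt => /orP[/eqP->//|jl].
  by apply: h1; rewrite tj.
move=> h; apply/andP; split; last by apply: h; rewrite leq_addr/=.
by apply/IH => j /andP[tj jl]; apply: h; rewrite tj ltnW.
Qed.

Section RotationEvents.
Variables (R : realType) (alpha eps : R) (eps0 : 0 < eps).
Variables (mu : probability (circle R) R) (mu_stationary : is_stationary alpha eps0 mu).
Context d (T : measurableType d) (P : probability T R).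
Variables (x0 : {RV P >-> circle R}) (w : nat -> {RV P >-> R}).
Hypothesis P_product : has_product_law mu (noise_law eps0) x0 w.
Variables (phi : circle R -> \bar R) (phi_measurable : measurable_fun setT phi).
Local Notation Q := (transition alpha eps0).
Local Notation Y := (orbit_at alpha x0 w).
Local Notation X := (fun n s => phi (Y n s)).

Definition exceedance (v : R) : set (circle R) := [set y | (v%:E < phi y)%E].
Local Notation U := exceedance.

Lemma measurable_exceedance v : measurable (U v).
Proof.
have := phi_measurable measurableT (emeasurable_itv `]v%:E, +oo[); rewrite setTI.
congr (measurable _); apply/seteqP; split => y /=; rewrite in_itv/= ?andbT//.
Qed.

Lemma not_exceedance v y : (~` U v) y <-> (phi y <= v%:E)%E.
Proof. by rewrite /exceedance /=; split => [/negP|]; rewrite leNgt// => h; apply/negP. Qed.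

Lemma exceedance_prob v : P [set s | (v%:E < X 0%N s)%E] = (\int[mu]_y \1_(U v) y)%:E.
Proof.
have [x0_law _ _] := P_product; have mU := measurable_exceedance v.
rewrite -[LHS]/(distribution P x0 (U v)) x0_law//.
by rewrite /Rintegral integral_indic// setIT fineK// fin_num_measure.
Qed.

Lemma exceedance_block_prob v t l :
  P [set s | (v%:E < X 0%N s)%E /\ (block_max X t l s <= v%:E)%E] =
  (\int[mu]_y (\1_(U v) y * iter t Q (stay alpha eps0 (~` U v) l) y))%:E.
Proof.
have mU := measurable_exceedance v.
rewrite -(hit_stay_prob alpha P_product _ _ mU (measurableC mU)).
congr (P _); apply/seteqP; split => s /= [Us h]; split => //.
  by move/block_max_leP : h => h j /h /not_exceedance.
by apply/block_max_leP => j /h /not_exceedance.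
Qed.

Lemma partial_max_prob v l :
  P [set s | (partial_max X l s <= v%:E)%E] = (\int[mu]_y stay alpha eps0 (~` U v) l y)%:E.
Proof.
have <- := stay_prob P_product mu_stationary 0 l (measurableC (measurable_exceedance v)).
congr (P _); apply/seteqP; split => s /= h.
  by move/block_max_leP : h => h j /h /not_exceedance.
by apply/block_max_leP => j /h /not_exceedance.
Qed.

Lemma joint_exceedance_prob v j :
  P [set s | (v%:E < X 0%N s)%E /\ (v%:E < X j s)%E] =
  (\int[mu]_y (\1_(U v) y * iter j Q \1_(U v) y))%:E.
Proof.
(* An exceedance at time [j] is a stay of length one in [U v] itself, and [stay] of length one is
   the indicator because [Q] fixes constants. *)
transitivity (P [set s | U v (x0 s) /\ forall i, (j <= i < j + 1)%N -> U v (Y i s)]).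
  congr (P _); apply/seteqP; split => s /= [Us h]; split => //.
    by move=> i; rewrite addn1 ltnS -eqn_leq => /eqP <-.
  by apply: h; rewrite addn1 ltnS leqnn.
have mU := measurable_exceedance v.
rewrite (hit_stay_prob alpha P_product _ _ mU mU); do 3 f_equal.
apply/funext => y; congr (_ * iter j Q _ y); apply/funext => z /=.
by rewrite transition_cst mulr1.
Qed.

End RotationEvents.

(** * Conditions D2 and D' and the exponential limit for the perturbed rotation *)

Theorem theorem1 (R : realType) (alpha eps : R) (eps0 : 0 < eps)
    (mu : probability (circle R) R)
    (mu_stationary : is_stationary alpha eps0 mu)
    (d : measure_display) (T : measurableType d) (P : probability T R)
    (x0 : {RV P >-> circle R}) (w : nat -> {RV P >-> R})
    (P_product : has_product_law mu (noise_law eps0) x0 w)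
    (phi : circle R -> \bar R) (z : circle R)
    (phi_measurable : measurable_fun setT phi)
    (phi_Ny : forall y, phi y <> -oo%E)
    (phi_max : forall y, (phi y <= phi z)%E)
    (phi_arcs : exists v : R, (v%:E < phi z)%E /\
       forall u : R, v < u -> (u%:E < phi z)%E ->
         open_arc_around z [set y | (u%:E < phi y)%E])
    (X := fun (n : nat) (s : T) =>
       phi (random_orbit alpha (fun i => w i s) n (x0 s)))
    (tau : R) (tau0 : 0 < tau)
    (u : nat -> R)
    (U := fun n : nat => [set y : circle R | ((u n)%:E < phi y)%E])
    (u_levels : normalizing_levels P X tau u)
    (u_cvg : (u n)%:E @[n --> \oo] --> phi z)
    (U_arcs : forall n, open_arc_around z (U n))
    (U_nested : forall n, U n.+1 `<=` U n)
    (U_cap : \bigcap_n U n = [set z]) :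
  (exists t_ : nat -> nat, cond_D2 P X u t_ /\ cond_D' P X u t_) /\
  evl_with_extremal_index P X 1 /\
  max_law_converges P X u (expR (- tau)).
Proof.
have [rho [rho_le rho0 rho_mixing]] := transition_mixing alpha eps0.
have [C C0 C_mean] := transition_le_mean mu_stationary.
pose V := exceedance phi.
have mV v : measurable (V v) by exact: measurable_exceedance.
pose p v : R := \int[mu]_y \1_(V v) y.
have PX v : P [set s | (v%:E < X 0%N s)%E] = (p v)%:E.
  exact: (exceedance_prob alpha P_product phi_measurable).
have PXX v j : P [set s | (v%:E < X 0%N s)%E /\ (v%:E < X j s)%E] =
    (\int[mu]_y (\1_(V v) y * iter j (transition alpha eps0) \1_(V v) y))%:E.
  exact: (joint_exceedance_prob alpha P_product phi_measurable).
have PXblock v t l :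
    P [set s | (v%:E < X 0%N s)%E /\ (block_max X t l s <= v%:E)%E] =
    (\int[mu]_y (\1_(V v) y * iter t (transition alpha eps0) (stay alpha eps0 (~` V v) l) y))%:E.
  exact: (exceedance_block_prob alpha P_product phi_measurable).
have Pmax v l : P [set s | (partial_max X l s <= v%:E)%E] =
    (\int[mu]_y stay alpha eps0 (~` V v) l y)%:E.
  exact: (partial_max_prob mu_stationary P_product phi_measurable).
have p01 v : 0 <= p v <= 1.
  rewrite -!lee_fin -PX measure_ge0/= probability_le1//.
  exact: (@measurable_funPTI _ _ _ _ x0 _ (mV v)).
have levelsP sigma v : normalizing_levels P X sigma v <->
    n%:R * p (v n) @[n --> \oo] --> sigma.
  rewrite -cvg_EFin_seq /normalizing_levels.
  by under eq_fun do rewrite PX -EFinM.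
(* Any rate and any levels are allowed, so that this covers both [u] and the reindexed levels used
   for the extreme value law. *)
have max_law sigma v : normalizing_levels P X sigma v ->
    max_law_converges P X v (expR (- sigma)).
  move=> /levelsP np; rewrite /max_law_converges.
  under eq_fun do rewrite Pmax.
  apply/cvg_EFin_seq; apply: (@cvg_of_power_approx _ rho _ (p \o v) (C + 1)) => //.
  - by rewrite addr_ge0// ltW.
  - by move=> n; exact: p01.
  - move=> t n; exact: (stay_mean_approx mu_stationary rho_le rho_mixing C0 C_mean (mV (v n))).
have np := (levelsP tau u).1 u_levels.
split; last split.
- exists (@gap); split.
    split; first exact: gap_little_o.
    (* With [t_ = gap], [n * gamma] equals [(n * p (u n)) * rho (gap n)], which tends to
       [tau * 0]. *)
    exists (fun n t => p (u n) * rho t); split.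
    + move=> l t n.
      rewrite PXblock PX Pmax.
      rewrite -EFinM -EFinB lee_fin.
      exact: (hit_stay_decorrelation mu_stationary rho_mixing (mV (u n))).
    + by move=> n t t' tt'; rewrite ler_wpM2l ?rho_le//; have /andP[] := p01 (u n).
    + under eq_fun do rewrite mulrA.
      rewrite -(mulr0 tau); apply: cvgM => //.
      by apply: (@cvg_comp _ _ _ gap rho _ \oo); [exact: cvg_gap|exact: rho0].
  exists gap; split; [exact: cvg_gap|exact: gap_sqr_little_o|].
  pose q n j : R := \int[mu]_y (\1_(V (u n)) y * iter j (transition alpha eps0) \1_(V (u n)) y).
  under eq_fun do under eq_bigr do rewrite PXX.
  under eq_fun do rewrite sumEFin -EFinM.
  apply/cvg_EFin_seq.
  (* At most [n / gap n] terms, each bounded by [C * p ^ 2], give after multiplication by [n] the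
     bound [C * (n p) ^ 2 / gap n]. *)
  apply: (@squeeze_cvgr _ _ _ _ (fun=> 0)
    (fun n => C * (n%:R * p (u n)) * (n%:R * p (u n)) * (gap n)%:R^-1)); last 2 first.
  + exact: cvg_cst.
  + rewrite -[X in _ --> X](mulr0 (C * tau * tau)); apply: cvgM; last first.
      by apply: (@cvg_comp _ _ _ gap (fun n => n%:R^-1) _ \oo); [exact: cvg_gap|exact: cvg_invn].
    by apply: cvgM => //; apply: cvgM => //; exact: cvg_cst.
  apply: nearW => n; have /andP[pn0 pn1] := p01 (u n).
  have q0 j : 0 <= q n j.
    apply: Rintegral_ge0 => y _; rewrite mulr_ge0//.
    apply: bounded_ge0_ge0; apply: iter_transition_bounded_ge0.
    exact: bounded_ge0_indic.
  rewrite mulr_ge0//=; last by apply: sumr_ge0 => j _; exact: q0.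
  apply: (@le_trans _ _ (n%:R * \sum_(1 <= j < (n %/ gap n).+1) (C * p (u n) * p (u n)))).
    rewrite ler_wpM2l// big_nat_cond [leRHS]big_nat_cond; apply: ler_sum => j /andP[/andP[j0 _] _].
    exact: (return_prob_le mu_stationary C_mean (mV (u n))).
  rewrite sumr_const_nat subn1/= -mulr_natl.
  have h : (n %/ gap n)%:R <= n%:R / (gap n)%:R :> R.
    (* For small [n] the gap is 0; both the integer and the real quotient are then 0 by
       convention. *)
    have [->|g0] := posnP (gap n); first by rewrite divn0 invr0 mulr0.
    by rewrite ler_pdivlMr ?ltr0n// -natrM ler_nat leq_trunc_div.
  have Cp : 0 <= n%:R * (C * p (u n) * p (u n)) by rewrite !mulr_ge0// ltW.
  by have := ler_wpM2l Cp h; lra.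
- split; first by rewrite ler01 lexx.
  exists (expo_cdf_cumulative R); split; last first.
    by move=> sigma sigma0; rewrite mulN1r; exact: expo_cdf_survival (ltW sigma0).
  split; [exact: expo_cdf_non_degenerate|exact: expo_cdf0|].
  move=> sigma sigma0.
  (* Levels for the rate [sigma], obtained from [u] by a linear change of time. *)
  pose v n := u (Num.truncn (n%:R * (tau / sigma))).
  have lv : normalizing_levels P X sigma v.
    by apply/levelsP; exact: (@cvg_subsequence_rate _ (p \o u)).
  exists v; split => // _.
  by rewrite (expo_cdf_survival (ltW sigma0)); exact: max_law.
- exact: max_law.
Qed.
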